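(* Let $n\ge 2$ and let $\gamma$ be a Coxeter element in $C_n$. The poset group $\Gamma(C_n,\gamma)$ is isomorphic to the Artin group $A(C_n)$.
   Context: $C_n$ is the finite reflection group of all $\alpha\in O(n)$ with $\alpha([-1,1]^n)=[-1,1]^n$. Its reflections are those in the hyperplanes $x_i=0$ and $x_i=\pm x_j$ ($i\neq j$). All Coxeter elements of $C_n$ are conjugate; one of them is the signed permutation $\gamma_C=[1,2,\dots,n]$, i.e. the $2n$-cycle $(1,2,\dots,n,-1,-2,\dots,-n)$ on the indices of $\{\pm e_1,\dots,\pm e_n\}$. For a finite reflection group $W$ with identity $I$, the reflection length $l(w)$ is the least $k$ such that $w$ is a product of $k$ reflections of $W$, and $u\le w$ means $l(w)=l(u)+l(u^{-1}w)$; this is a partial order on $W$. For $\gamma\in W$, write $(I,\gamma]$ for the set of $w\in W$ with $w\le\gamma$, $w\ne I$. The poset group $\Gamma(W,\gamma)$ is the group with one generator $\{w\}$ for each $w\in(I,\gamma]$ and with relations $\{w_1\}\{w_2\}=\{w_3\}$ for all $w_1,w_2,w_3\in(I,\gamma]$ with $w_1\le w_3$ and $w_2=w_1^{-1}w_3$. The Artin group $A(C_n)$ has generators $x_1,\dots,x_n$ and relations $x_1x_2x_1x_2=x_2x_1x_2x_1$; $x_ix_{i+1}x_i=x_{i+1}x_ix_{i+1}$ for $1<i<n$; $x_ix_j=x_jx_i$ for $|j-i|\ge 2$. *)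

(* Defs.v *)
From HB Require Import structures.
From mathcomp Require Import all_boot all_order all_algebra.
From mathcomp Require Import generic_quotient.
From mathcomp Require Import boolp classical_sets reals.

Set Implicit Arguments.
Unset Strict Implicit.
Unset Printing Implicit Defensive.

Import Order.TTheory GRing.Theory Num.Theory.
Local Open Scope ring_scope.
Local Open Scope classical_set_scope.
Local Open Scope quotient_scope.

(* The letter [(s, true)] stands for the generator [s] and [(s, false)] for
   its inverse. *)
Definition word (S : Type) := seq (S * bool).

Definition letter (S : Type) (s : S) : S * bool := (s, true).

Definition word_inv (S : Type) (w : word S) : word S :=
  rev [seq (x.1, ~~ x.2) | x <- w].

Section Presentation.
Variables (S : choiceType) (rels : word S -> word S -> Prop).

(* The least congruence on words that contains [rels] and makes [(s, ~~ b)]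
   inverse to [(s, b)]. *)
Inductive pres_eq : word S -> word S -> Prop :=
| pres_rel u v : rels u v -> pres_eq u v
| pres_cancel s b : pres_eq [:: (s, b); (s, ~~ b)] [::]
| pres_refl u : pres_eq u u
| pres_sym u v : pres_eq u v -> pres_eq v u
| pres_trans v u w : pres_eq u v -> pres_eq v w -> pres_eq u w
| pres_cat u u' v v' :
    pres_eq u u' -> pres_eq v v' -> pres_eq (u ++ v) (u' ++ v').

Definition pres_eqb : rel (word S) := fun u v => `[< pres_eq u v >].

Lemma pres_eqb_refl : reflexive pres_eqb.
Proof. by move=> u; apply/asboolP; exact: pres_refl. Qed.

Lemma pres_eqb_sym : symmetric pres_eqb.
Proof. by move=> u v; apply/asboolP/asboolP; exact: pres_sym. Qed.

Lemma pres_eqb_trans : transitive pres_eqb.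
Proof.
by move=> v u w /asboolP uv /asboolP vw; apply/asboolP; exact: pres_trans vw.
Qed.

Canonical pres_equiv :=
  EquivRel pres_eqb pres_eqb_refl pres_eqb_sym pres_eqb_trans.

Definition presented := {eq_quot pres_equiv}.
HB.instance Definition _ : EqQuotient _ pres_equiv presented :=
  EqQuotient.on presented.
HB.instance Definition _ := Choice.on presented.

Definition pres_class (w : word S) : presented := \pi_presented w.

Lemma pres_classP u v : pres_class u = pres_class v <-> pres_eq u v.
Proof.
split; first by move/eqquotP/asboolP.
by move=> uv; apply/eqquotP/asboolP.
Qed.

Lemma pres_classK (x : presented) : pres_class (repr x) = x.
Proof. exact: reprK. Qed.

Lemma pres_repr (w : word S) : pres_eq (repr (pres_class w)) w.
Proof. by apply/pres_classP; rewrite pres_classK. Qed.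

Lemma pres_cancel_word u : pres_eq (u ++ word_inv u) [::].
Proof.
elim: u => [|[s b] u IH]; first exact: pres_refl.
have -> : ((s, b) :: u) ++ word_inv ((s, b) :: u) =
    [:: (s, b)] ++ ((u ++ word_inv u) ++ [:: (s, ~~ b)]).
  by rewrite /word_inv /= rev_cons -cats1 catA.
apply: (pres_trans (v := [:: (s, b)] ++ ([::] ++ [:: (s, ~~ b)]))).
  apply: pres_cat; first exact: pres_refl.
  by apply: pres_cat; [exact: IH | exact: pres_refl].
exact: pres_cancel.
Qed.

Lemma word_invK (u : word S) : word_inv (word_inv u) = u.
Proof.
rewrite /word_inv map_rev revK -map_comp -[RHS]map_id.
by apply: eq_map => -[s b] /=; rewrite negbK.
Qed.

Lemma pres_cancel_wordV u : pres_eq (word_inv u ++ u) [::].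
Proof. by rewrite -{2}[u]word_invK; exact: pres_cancel_word. Qed.

Definition pres_mul (x y : presented) : presented :=
  pres_class (repr x ++ repr y).
Definition pres_one : presented := pres_class [::].
Definition pres_inv (x : presented) : presented :=
  pres_class (word_inv (repr x)).

Lemma pres_mulA : associative pres_mul.
Proof.
move=> x y z; apply/pres_classP.
apply: (pres_trans (v := repr x ++ (repr y ++ repr z))).
  by apply: pres_cat; [exact: pres_refl | exact: pres_repr].
rewrite catA; apply: pres_cat; last exact: pres_refl.
by apply: pres_sym; exact: pres_repr.
Qed.

Lemma pres_mul1 : left_id pres_one pres_mul.
Proof.
move=> x; rewrite -[RHS]pres_classK; apply/pres_classP.
by apply: (pres_cat (u' := [::])); [exact: pres_repr | exact: pres_refl].
Qed.

Lemma pres_mulr1 : right_id pres_one pres_mul.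
Proof.
move=> x; rewrite -[RHS]pres_classK; apply/pres_classP.
rewrite -[X in pres_eq _ X]cats0.
by apply: pres_cat; [exact: pres_refl | exact: pres_repr].
Qed.

Lemma pres_mulV : left_inverse pres_one pres_inv pres_mul.
Proof.
move=> x; apply/pres_classP.
apply: (pres_trans _ (pres_cancel_wordV (repr x))).
by apply: pres_cat; [exact: pres_repr | exact: pres_refl].
Qed.

Lemma pres_mulrV : right_inverse pres_one pres_inv pres_mul.
Proof.
move=> x; apply/pres_classP.
apply: (pres_trans _ (pres_cancel_word (repr x))).
by apply: pres_cat; [exact: pres_refl | exact: pres_repr].
Qed.

HB.instance Definition _ := isGroup.Build presented
  pres_mulA pres_mul1 pres_mulr1 pres_mulV pres_mulrV.

End Presentation.

Definition isomorphic (G H : groupType) : Prop :=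
  exists f : {multiplicative G -> H}, bijective f.

Section Reflections.
Variables (R : realType) (n : nat).
Implicit Types (v : 'cV[R]_n) (u w : 'M[R]_n) (W : set 'M[R]_n).

(* x |-> x - 2 <v, x> / <v, v> v *)
Definition reflection v : 'M[R]_n :=
  1%:M - (2 / (v^T *m v) 0 0) *: (v *m v^T).

(* [v] is normal to the hyperplane of a reflection of [W]; it is not
   normalised. *)
Definition is_root W v : Prop := v != 0 /\ W (reflection v).

Definition is_reflection W w : Prop :=
  exists2 v, is_root W v & w = reflection v.

Definition refl_product W w (k : nat) : Prop :=
  exists2 r : 'I_k -> 'M[R]_n, (forall i, is_reflection W (r i)) &
    w = \big[mulmx/1%:M]_(i < k) r i.

Lemma refl_product_exb W w :
  (exists k, refl_product W w k) -> exists k, `[< refl_product W w k >].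
Proof. by case=> k wk; exists k; apply/asboolP. Qed.

(* The value 0 off the subgroup generated by the reflections of [W] is junk;
   a reflection group [W] is equal to that subgroup. *)
Definition refl_length W w : nat :=
  if pselect (exists k, refl_product W w k) is left wk
  then ex_minn (refl_product_exb wk) else 0%N.

(* To be used for [u] and [w] in [W]. *)
Definition refl_le W u w : Prop :=
  refl_length W w = (refl_length W u + refl_length W (invmx u *m w))%N.

(* The columns of [A] are linearly independent roots, and every root is a
   combination of them with coefficients all of the same sign. *)
Definition simple_system W m (A : 'M[R]_(n, m)) : Prop :=
  [/\ row_free A^T,
      forall i, is_root W (col i A) &
      forall v, is_root W v -> exists2 c : 'cV[R]_m, v = A *m c &
        (forall i, 0 <= c i 0) \/ (forall i, c i 0 <= 0)].

(* A product of the simple reflections, each occurring once. The order is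
   arbitrary since that of the columns of a simple system is. *)
Definition coxeter_element W w : Prop :=
  exists m, exists2 A : 'M[R]_(n, m), simple_system W A &
    w = \big[mulmx/1%:M]_(i < m) reflection (col i A).

(* (I, g] *)
Definition poset_interval W (g : 'M[R]_n) : set 'M[R]_n :=
  [set w | [/\ W w, refl_le W w g & w <> 1%:M]].

Inductive poset_rels W (g : 'M[R]_n) :
    word (poset_interval W g) -> word (poset_interval W g) -> Prop :=
| PosetRel (w1 w2 w3 : poset_interval W g) :
    refl_le W (val w1) (val w3) -> val w2 = invmx (val w1) *m val w3 ->
    poset_rels [:: letter w1; letter w2] [:: letter w3].

Definition poset_group W (g : 'M[R]_n) : groupType :=
  presented (@poset_rels W g).

Definition cube : set 'cV[R]_n := [set x | forall i, -1 <= x i 0 <= 1].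

Definition group_C : set 'M[R]_n :=
  [set a | a^T *m a = 1%:M /\ [set a *m x | x in cube] = cube].

End Reflections.

(* The generator x_(i+1) is [i : 'I_n]. *)
Inductive artin_C_rels (n : nat) : word 'I_n -> word 'I_n -> Prop :=
| ArtinBraid4 (i j : 'I_n) : i = 0%N :> nat -> j = 1%N :> nat ->
    artin_C_rels [:: letter i; letter j; letter i; letter j]
                 [:: letter j; letter i; letter j; letter i]
| ArtinBraid3 (i j : 'I_n) : (0 < i)%N -> j = i.+1 :> nat ->
    artin_C_rels [:: letter i; letter j; letter i]
                 [:: letter j; letter i; letter j]
| ArtinComm (i j : 'I_n) : (i.+2 <= j)%N || (j.+2 <= i)%N ->
    artin_C_rels [:: letter i; letter j] [:: letter j; letter i].

Definition artin_C (n : nat) : groupType := presented (@artin_C_rels n).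

(* Main.v *)
Require Import Defs.
From HB Require Import structures.
From mathcomp Require Import all_boot all_order all_algebra.
From mathcomp Require Import perm.
From mathcomp Require Import boolp classical_sets reals.
From mathcomp Require Import zify ring.

Set Implicit Arguments.
Unset Strict Implicit.
Unset Printing Implicit Defensive.

Import Order.TTheory GRing.Theory Num.Theory.

(** A Coxeter element [g] of the group of the cube permutes the [2n] signed
    basis vectors in a single cycle ([simple_product_cycle]). So the vectors
    [b p = g^p b_0] are the vertices of a [2n]-gon that [g] rotates by one
    step, with [b (p + n) = - b p]. The reflections of the group are the chords
    of this polygon up to the half turn: for [i < j <= i + n] the chord [i, j]
    is the reflection in [b i - b j], which exchanges [b i] with [b j] and
    [- b i] with [- b j]; the diameters [j = i + n] are the sign changes.
    Reflection length is the rank of [w - 1] ([refl_lengthE]), which turns the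
    order below [g] into statements about fixed vectors and orbits.

    Two groups are to be compared. In the poset group an element [w <= g] is
    the product of the letters of any of its reduced factorisations into
    reflections. Hence an assignment of elements of some group to the chords
    extends to the poset group as soon as all the reduced factorisations of
    each [w <= g] get the same product. By Hurwitz transitivity
    ([Lword_reduced]) it suffices to compare the factorisations [t t'] and
    [t' (t' t t')] of the elements of length two. By [pair_cases] the chords
    of such a pair are disjoint, nested, or have a vertex in common up to
    sign, so this means finitely many shapes of relations between chords.

    In the Artin group, with generators [x_0, ..., x_(n-1)], the product
    [tau = x_0 ... x_(n-1)] plays the part of the rotation. The braid relations
    of length three give [tau x_k = x_(k+1) tau] for [0 < k < n - 1], and
    together with that of length four they give [tau^2 x_(n-1) = x_1 tau^2].
    So the conjugates [s_p = tau^p x_1 tau^-p], which are to lift the sides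
    [p, p + 1], have period [n]. With [c(i, j) = s_i ... s_(j-1)] for
    [j < i + n] and [c(i, i + n) = tau], the chord [i, j] is lifted to
    [c(i, j) c(i, j - 1)^-1]. Conjugation by [c(i, j)] shifts the indices of
    the chords inside [i, j[ ([cyc_shift]), and all the relations required of
    the lifts follow from this.

    In the other direction [x_0] goes to the diameter [0, n] and [x_(p+1)] to
    the side [p, p + 1]. The Artin relations hold in the poset group because
    they hold for the chords of a triangle or a square with
    [t t' = t' (t' t t')], and [tau] goes to [g]. The two maps are inverse to
    each other: the side [0, 1] and the diameter [0, n] generate all the
    chords by rotation and the triangle relations, and these are the same for
    the elements of the poset group as for the lifts. *)

(** * Maps out of a presented group *)

Section PresentedGroups.
Local Open Scope group_scope.
Variables (S : choiceType) (rels : word S -> word S -> Prop).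

Definition gen (s : S) : presented rels := pres_class rels [:: letter s].

Lemma pres_classM u v :
  pres_class rels (u ++ v) = pres_class rels u * pres_class rels v.
Proof. by apply/pres_classP/pres_sym/pres_cat; exact: pres_repr. Qed.

Lemma pres_class1 : pres_class rels [::] = 1.
Proof. by []. Qed.

Lemma pres_class_cons s w :
  pres_class rels (letter s :: w) = gen s * pres_class rels w.
Proof. exact: (pres_classM [:: letter s]). Qed.

Lemma pres_classV s b :
  pres_class rels [:: (s, b)] = if b then gen s else (gen s)^-1.
Proof.
case: b => //; apply/esym/mulg1_eq; rewrite -pres_classM.
by apply/pres_classP; exact: pres_cancel.
Qed.

Variables (H : groupType) (f : S -> H).

Definition eval_word (w : word S) : H :=
  \prod_(x <- w) (if x.2 then f x.1 else (f x.1)^-1).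

Lemma eval_word_cat u v : eval_word (u ++ v) = eval_word u * eval_word v.
Proof. by rewrite /eval_word big_cat. Qed.

Hypothesis f_rels : forall u v, rels u v -> eval_word u = eval_word v.

Lemma eval_word_eq u v : pres_eq rels u v -> eval_word u = eval_word v.
Proof.
elim=> {u v} [u v /f_rels //|s b|//|u v _ //|v u w _ -> _ //|u u' v v' _ Hu _ Hv].
  by rewrite /eval_word !big_cons big_nil; case: b; rewrite /= mulg1 ?mulgV ?mulVg.
by rewrite !eval_word_cat Hu Hv.
Qed.

Definition pres_lift (x : presented rels) : H := eval_word (repr x).

Lemma pres_liftM : {morph pres_lift : x y / x * y}.
Proof.
move=> x y; rewrite -eval_word_cat; apply: eval_word_eq; exact: pres_repr.
Qed.

Lemma pres_lift_gen s : pres_lift (gen s) = f s.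
Proof.
have /eval_word_eq := pres_repr rels [:: letter s].
by rewrite /pres_lift => ->; rewrite /eval_word big_seq1.
Qed.

End PresentedGroups.

Section MultiplicativeMaps.
Local Open Scope group_scope.
Variables (G H : groupType) (p : G -> H).
Hypothesis pM : {morph p : x y / x * y}.

Lemma morph_mul1 : p 1 = 1.
Proof. by apply: (mulgI (p 1)); rewrite -pM !mulg1. Qed.

Lemma morph_mulV : {morph p : x / x^-1}.
Proof.
by move=> x; apply: (mulgI (p x)); rewrite -pM !mulgV morph_mul1.
Qed.

Lemma morph_mul_prod (I : Type) (r : seq I) (P : pred I) (F : I -> G) :
  p (\prod_(i <- r | P i) F i) = \prod_(i <- r | P i) p (F i).
Proof. exact: (big_morph p pM morph_mul1). Qed.

End MultiplicativeMaps.

(** Two maps to compare are rarely packed as morphisms: usually one of them is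
    a composite of functions or the identity. *)
Lemma pres_ext (S : choiceType) (rels : word S -> word S -> Prop)
    (H : groupType) (p q : presented rels -> H) :
    {morph p : x y / (x * y)%g} -> {morph q : x y / (x * y)%g} ->
  (forall s, p (gen rels s) = q (gen rels s)) -> p =1 q.
Proof.
move=> pM qM pq x; rewrite -(pres_classK x); elim: (repr x) => [|[s b] u IH].
  by rewrite pres_class1 (morph_mul1 pM) (morph_mul1 qM).
rewrite -cat1s pres_classM pM qM IH pres_classV; case: b; rewrite ?pq //.
by rewrite (morph_mulV pM) (morph_mulV qM) pq.
Qed.

Lemma intertwineV (G : groupType) (a x y : G) :
  (a * x = y * a -> a * x^-1 = y^-1 * a)%g.
Proof. by move=> E; apply: (mulgI y); rewrite mulgA -E mulgK mulVKg. Qed.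

(** * Lifts of the chords of a polygon

    [s p] lifts the side [p, p + 1] of a [2n]-gon and [tau] its rotation by
    one step. *)
Section DualBraidRelations.
Local Open Scope group_scope.
Variables (G : groupType) (n : nat) (s : nat -> G) (tau : G).
Hypothesis n_gt1 : (1 < n)%N.
Hypothesis tau_s : forall i, tau * s i = s i.+1 * tau.
Hypothesis s_per : forall i, s (i + n)%N = s i.
Hypothesis s_braid : forall i, (2 < n)%N ->
  s i * s i.+1 * s i = s i.+1 * s i * s i.+1.
Hypothesis s_comm : forall i j, (i.+2 <= j)%N -> (j.+2 <= i + n)%N ->
  commute (s i) (s j).

(** The lift of the cyclic permutation of the vertices [i, ..., j]. For
    [j = i + n] that is the rotation of the whole polygon, which is not the
    product of [n] consecutive sides; the separate value makes the formula for
    chords cover the diameters. *)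
Definition cyc i j : G :=
  if (j == i + n)%N then tau else \prod_(i <= p < j) s p.

Fact chord_key : unit. Proof. exact: tt. Qed.
(** The cycle through [i, ..., j] followed back by the one through
    [i, ..., j - 1] exchanges [i] and [j]. The definition is locked to keep
    rewriting with associativity from opening it. *)
Definition chord i j : G := locked_with chord_key (cyc i j * (cyc i j.-1)^-1).

Lemma chordE i j : chord i j = cyc i j * (cyc i j.-1)^-1.
Proof. by rewrite /chord unlock. Qed.

Lemma cyc_lt i j : (j < i + n)%N -> cyc i j = \prod_(i <= p < j) s p.
Proof. by rewrite /cyc; case: eqP => // ->; rewrite ltnn. Qed.

Lemma cyc_full i : cyc i (i + n) = tau.
Proof. by rewrite /cyc eqxx. Qed.

Lemma cycii i : cyc i i = 1.
Proof. by rewrite cyc_lt ?big_geq //; lia. Qed.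

Lemma cyc_cat i j k : (i <= j <= k)%N -> (k < i + n)%N ->
  cyc i k = cyc i j * cyc j k.
Proof.
move=> /andP[ij jk] kn; rewrite !cyc_lt; try lia.
by rewrite (big_cat_nat ij jk).
Qed.

Lemma cyc1 i : cyc i i.+1 = s i.
Proof. by rewrite cyc_lt ?big_nat1 //; lia. Qed.

Lemma cycS i j : (i <= j)%N -> (j.+1 < i + n)%N -> cyc i j.+1 = cyc i j * s j.
Proof. by move=> ij jn; rewrite -cyc1 -cyc_cat //; lia. Qed.

Lemma cyc_commute m i j : (j < m)%N -> (m.+1 < i + n)%N ->
  commute (cyc i j) (s m).
Proof.
move=> jm mi; rewrite cyc_lt; last by lia.
apply/commute_sym; rewrite big_nat; apply: commute_prod => p /andP[ip pj].
by apply/commute_sym/s_comm; lia.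
Qed.

Lemma commute_cyc m i j : (m.+1 < i)%N -> (j < m + n)%N ->
  commute (s m) (cyc i j).
Proof.
move=> mi jm; rewrite cyc_lt; last by lia.
by rewrite big_nat; apply: commute_prod => p /andP[ip pj]; apply: s_comm; lia.
Qed.

Lemma cyc_commute_cyc i j k l : (i <= j)%N -> (j < k)%N -> (k <= l)%N ->
  (l < i + n)%N -> commute (cyc i j) (cyc k l).
Proof.
move=> ij jk kl li; rewrite (@cyc_lt k); last by lia.
rewrite big_nat; apply: commute_prod => p /andP[kp pl].
by apply: cyc_commute; lia.
Qed.

(** All the factors but [s k] and [s k.+1] commute with what is moved past
    them, and for these two it is the braid relation. *)
Lemma cyc_shift_s i j k : (i <= k)%N -> (k.+1 < j <= i + n)%N ->
  cyc i j * s k = s k.+1 * cyc i j.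
Proof.
move=> ik /andP[kj]; rewrite leq_eqVlt => /orP[/eqP->|jn].
  by rewrite cyc_full tau_s.
rewrite (@cyc_cat i k j); try lia.
rewrite (@cyc_cat k k.+2 j); try lia.
rewrite (@cyc_cat k k.+1 k.+2) ?cyc1; try lia.
have H1 : s k.+1 * cyc i k = cyc i k * s k.+1 by apply/esym/cyc_commute; lia.
have H2 : cyc k.+2 j * s k = s k * cyc k.+2 j by apply/esym/commute_cyc; lia.
have H3 := @s_braid k ltac:(lia).
by rewrite [RHS]mulgA H1 -!mulgA H2; congr (_ * _); rewrite !mulgA H3.
Qed.

Lemma cyc_shift i j k l : (i <= k <= l)%N -> (l < j <= i + n)%N ->
  cyc i j * cyc k l = cyc k.+1 l.+1 * cyc i j.
Proof.
move=> /andP[ik]; elim: l => [|l IH].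
  by rewrite leqn0 => /eqP-> _; rewrite !cycii mul1g mulg1.
rewrite leq_eqVlt => /orP[/eqP->|kl] lj; first by rewrite !cycii mul1g mulg1.
rewrite cycS; try lia.
rewrite mulgA IH; try lia.
rewrite -mulgA cyc_shift_s; try lia.
by rewrite mulgA -cycS //; lia.
Qed.

Lemma chord_shift i j k l : (i <= k < l)%N -> (l < j <= i + n)%N ->
  cyc i j * chord k l = chord k.+1 l.+1 * cyc i j.
Proof.
move=> ikl lj; rewrite !chordE mulgA cyc_shift; try lia.
have := @cyc_shift i j k l.-1 ltac:(lia) ltac:(lia).
rewrite prednK /=; last by lia.
by move=> /intertwineV E; rewrite -mulgA E !mulgA.
Qed.

(** Compared with [chord_shift] for the cycle [tau], this includes the
    diameter. *)
Lemma tau_chord i j : (i < j <= i + n)%N ->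
  tau * chord i j = chord i.+1 j.+1 * tau.
Proof.
move=> ij; have tau_cyc k : (i <= k <= i + n)%N ->
    tau * cyc i k = cyc i.+1 k.+1 * tau.
  move=> ik; case: (eqVneq k (i + n)%N) => [->|kn].
    by rewrite -addSn !cyc_full.
  by rewrite -(cyc_full i) cyc_shift //; lia.
rewrite !chordE mulgA tau_cyc; last by lia.
have := @tau_cyc j.-1 ltac:(lia).
rewrite prednK /=; last by lia.
by move=> /intertwineV E; rewrite -mulgA E !mulgA.
Qed.

Lemma cyc_per i j : cyc (i + n) (j + n) = cyc i j.
Proof.
rewrite /cyc eqn_add2r; case: eqP => // _.
by rewrite big_addn addnK; apply: eq_bigr => p _; exact: s_per.
Qed.

Lemma chord_per i j : (i < j)%N -> chord (i + n) (j + n) = chord i j.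
Proof. by case: j => // j _; rewrite !chordE addSn /= -addSn !cyc_per. Qed.

Lemma chord_cyc i j : chord i j * cyc i j.-1 = cyc i j.
Proof. by rewrite chordE mulgVK. Qed.

Lemma cyc_chord i j : (i < j <= i + n)%N -> cyc i.+1 j * chord i j = cyc i j.
Proof.
move=> ij; apply: (mulIg (cyc i j.-1)); rewrite -mulgA chord_cyc.
rewrite cyc_shift ?prednK //; lia.
Qed.

Lemma chord1 i : chord i i.+1 = s i.
Proof. by rewrite chordE /= cyc1 cycii invg1 mulg1. Qed.

Lemma chord_disjoint i j k l :
  (i < j)%N -> (j < k)%N -> (k < l)%N -> (l < i + n)%N ->
  chord i j * chord k l = chord k l * chord i j.
Proof.
move=> ij jk kl li; suff Ci a : (i <= a <= j)%N -> commute (cyc i a) (chord k l).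
  rewrite [chord i j]chordE; apply: commute_sym.
  apply: commuteM; first by apply/commute_sym/Ci; lia.
  by apply/commuteV/commute_sym/Ci; lia.
move=> ia; rewrite chordE; apply: commuteM; first by apply: cyc_commute_cyc; lia.
by apply/commuteV/cyc_commute_cyc; lia.
Qed.

(** Conjugation by [cyc i j] and conjugation by [cyc i j.-1] both shift
    [k - 1, l - 1] to [k, l], so that their quotient commutes with
    the chord [k, l]. *)
Lemma chord_nested i j k l : (i < k < l)%N -> (l < j <= i + n)%N ->
  chord i j * chord k l = chord k l * chord i j.
Proof.
move=> ikl lj.
have := @chord_shift i j k.-1 l.-1 ltac:(lia) ltac:(lia).
have := @chord_shift i j.-1 k.-1 l.-1 ltac:(lia) ltac:(lia).
rewrite !prednK; try lia.
move=> E2 E1.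
have E3 : (cyc i j.-1)^-1 * chord k l = chord k.-1 l.-1 * (cyc i j.-1)^-1.
  by apply: (mulgI (cyc i j.-1)); rewrite mulVKg mulgA E2 mulgK.
by rewrite [chord i j]chordE -mulgA E3 mulgA E1 -mulgA.
Qed.

(** The start of a chord may be moved by conjugation with the cycle between
    the old start and the new one; [chord_cyc_glue] does this for the end.
    The triangle relations are these two with one factor cancelled. *)
Lemma cyc_chord_glue i j k : (i <= j < k)%N -> (k < i + n)%N ->
  cyc i j * chord j k = chord i k * cyc i j.
Proof.
move=> ijk kn; apply: (mulIg (cyc j k.-1)).
rewrite -!mulgA chord_cyc -cyc_cat; try lia.
by rewrite -cyc_cat ?chord_cyc //; lia.
Qed.

Lemma chord_cyc_glue i j k : (i < j <= k)%N -> (k < i + n)%N ->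
  chord i j * cyc j k = cyc j k * chord i k.
Proof.
move=> ijk kn; apply: (mulgI (cyc i.+1 j)).
rewrite mulgA cyc_chord; last by lia.
by rewrite -cyc_cat ?mulgA -?cyc_cat ?cyc_chord //; lia.
Qed.

Lemma chord_triangle1 i j k : (i < j < k)%N -> (k < i + n)%N ->
  chord i j * chord j k = chord i k * chord i j.
Proof.
move=> ijk kn; apply: (mulIg (cyc i j.-1)).
rewrite -[RHS]mulgA chord_cyc -cyc_chord_glue; try lia.
rewrite -(chord_cyc i j) -!mulgA; congr (_ * _); apply/esym.
rewrite chordE; apply: commuteM; first by apply: cyc_commute_cyc; lia.
by apply/commuteV/cyc_commute_cyc; lia.
Qed.

Lemma chord_triangle2 i j k : (i < j < k)%N -> (k < i + n)%N ->
  chord i j * chord j k = chord j k * chord i k.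
Proof.
move=> ijk kn; apply: (mulgI (cyc j.+1 k)).
rewrite [RHS]mulgA cyc_chord; last by lia.
rewrite -chord_cyc_glue; try lia.
rewrite -(@cyc_chord j k) ?mulgA; last by lia.
congr (_ * _); rewrite chordE; apply: commuteM.
  by apply/commute_sym/cyc_commute_cyc; lia.
by apply/commuteV/commute_sym/cyc_commute_cyc; lia.
Qed.

(** The relations of the square with vertices [i], [j], [i + n], [j + n]. Here
    the diameters make [tau] enter, and the shift of indices by [tau] passes
    the point where they start again modulo [n]. *)
Lemma chord_square1 i j : (i < j < i + n)%N ->
  chord i (i + n) * chord i j = chord i j * chord j (j + n).
Proof.
move=> ij; suff H : chord i (i + n) * cyc i j = cyc i j * chord j (j + n).
  apply: (mulIg (cyc i j.-1)); rewrite -mulgA chord_cyc H -(chord_cyc i j).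
  rewrite -!mulgA; congr (_ * _).
  rewrite -(cyc_per i j.-1).
  suff C : commute (chord j (j + n)) (cyc (i + n) (j.-1 + n)) by exact/esym.
  rewrite cyc_lt; last by lia.
  rewrite big_nat; apply: commute_prod => p /andP[ip pj].
  by rewrite -chord1; apply: chord_nested; lia.
have tau_cyc : cyc i j * tau = tau * cyc (i + n).-1 (j + n).-1.
  rewrite -(cyc_full (i + n).-1).
  have := @cyc_shift (i + n).-1 ((i + n).-1 + n) (i + n).-1 (j + n).-1.
  rewrite !prednK; try lia.
  by rewrite cyc_per => -> //; lia.
rewrite !chordE !cyc_full mulgA tau_cyc.
rewrite (@cyc_cat i j (i + n).-1); try lia.
rewrite (@cyc_cat j (i + n).-1 (j + n).-1); try lia.
by rewrite !invgM !mulgA mulgVK mulgK.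
Qed.

Lemma chord_square2 i j : (i < j < i + n)%N ->
  chord i j * chord j (j + n) = chord j (j + n) * chord j (i + n).
Proof.
move=> ij.
have H : cyc (i + n).-1 (j + n).-1 * chord (i + n).-1 (j + n).-1 =
    s (i + n).-1 * cyc (i + n).-1 (j + n).-1.
  apply: (mulIg (cyc (i + n).-1 (j + n).-1.-1)).
  rewrite -mulgA chord_cyc -[RHS]mulgA [X in _ = _ * X]cyc_shift; try lia.
  rewrite [RHS]mulgA; congr (_ * _).
  rewrite [(j + n).-1.-1.+1]prednK; last by lia.
  by rewrite -cyc1 -cyc_cat //; lia.
rewrite -[chord i j]chord_per; last by lia.
rewrite [chord j (j + n)]chordE !cyc_full.
have := @tau_chord (i + n).-1 (j + n).-1 ltac:(lia).
rewrite !prednK; try lia.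
move=> E; rewrite mulgA -E -!mulgA; congr (_ * _).
rewrite (@cyc_cat j (i + n).-1 (j + n).-1); try lia.
apply: (mulgI (cyc j (i + n).-1 * cyc (i + n).-1 (j + n).-1)).
rewrite mulVKg -!mulgA invgM [X in _ * X = _]mulgA [_ * (_ * _)]mulgA.
rewrite H -!mulgA mulVKg [LHS]mulgA -cyc1 -cyc_cat; try lia.
by rewrite chordE prednK //; lia.
Qed.

End DualBraidRelations.

(** * The rotation in the Artin group *)
Section ArtinRotation.
Local Open Scope group_scope.
Variables (G : groupType) (n : nat) (x : nat -> G).
Hypothesis n_gt1 : (1 < n)%N.
Hypothesis x_braid4 : x 0 * x 1 * x 0 * x 1 = x 1 * x 0 * x 1 * x 0.
Hypothesis x_braid3 : forall i, (0 < i)%N -> (i.+1 < n)%N ->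
  x i * x i.+1 * x i = x i.+1 * x i * x i.+1.
Hypothesis x_comm : forall i j, (i.+2 <= j)%N -> (j < n)%N ->
  commute (x i) (x j).

Definition cox_prod : G := \prod_(0 <= p < n) x p.
(** The lift of the side [i, i + 1]; the first side is lifted to [x 1]. *)
Definition rotated i : G := cox_prod ^+ i * x 1 * cox_prod ^- i.

Let d i j := \prod_(i <= p < j) x p.

Let d_cat i j k : (i <= j <= k)%N -> d i k = d i j * d j k.
Proof. by move=> /andP[ij jk]; rewrite /d (big_cat_nat ij jk). Qed.

Let d1 i : d i i.+1 = x i. Proof. by rewrite /d big_nat1. Qed.

Let dii i : d i i = 1. Proof. by rewrite /d big_geq. Qed.

Let d_comm i j k : (j < k)%N -> (k < n)%N -> commute (d i j) (x k).
Proof.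
move=> jk kn; apply: commute_sym; rewrite /d big_nat.
by apply: commute_prod => p /andP[_ pj]; apply/commute_sym/x_comm; lia.
Qed.

Let d_comm' k i j : (k.+1 < i)%N -> (j <= n)%N -> commute (x k) (d i j).
Proof.
move=> ki jn; rewrite /d big_nat.
by apply: commute_prod => p /andP[ip pj]; apply: x_comm; lia.
Qed.

Let d_shift_x i j k : (i <= k)%N -> (0 < k)%N -> (k.+1 < j <= n)%N ->
  d i j * x k = x k.+1 * d i j.
Proof.
move=> ik k0 /andP[kj jn].
rewrite (@d_cat i k j) ?(@d_cat k k.+2 j) ?(@d_cat k k.+1 k.+2) ?d1; try lia.
have H1 : x k.+1 * d i k = d i k * x k.+1 by apply/esym/d_comm; lia.
have H2 : d k.+2 j * x k = x k * d k.+2 j by apply/esym/d_comm'; lia.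
have H3 := @x_braid3 k ltac:(lia) ltac:(lia).
by rewrite [RHS]mulgA H1 -!mulgA H2; congr (_ * _); rewrite !mulgA H3.
Qed.

Lemma cox_prod_shift k : (0 < k)%N -> (k.+1 < n)%N ->
  cox_prod * x k = x k.+1 * cox_prod.
Proof. by move=> k0 kn; apply: d_shift_x; lia. Qed.

(** Conjugation by the Coxeter product moves [x 1] to [x 2], and so on up to
    [x n.-1]; it takes two more turns to come back to [x 1]. The braid relation
    of length four enters here. *)
Lemma cox_prod_square : cox_prod * cox_prod * x n.-1 = x 1 * (cox_prod * cox_prod).
Proof.
have K : d 1 n * d 1 n = d 2 n * d 1 n * x n.-1.
  have dE : d 1 n = d 1 n.-1 * x n.-1.
    by rewrite (@d_cat 1 n.-1 n) -?d1 ?prednK //; lia.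
  rewrite {2}dE mulgA; congr (_ * _).
  suff shift m : (0 < m < n)%N -> d 1 n * d 1 m = d 2 m.+1 * d 1 n.
    by rewrite shift ?prednK //; lia.
  elim: m => // -[|m] IH mn; first by rewrite !dii mulg1 mul1g.
  rewrite (@d_cat 1 m.+1 m.+2); last by lia.
  rewrite d1 mulgA IH; last by lia.
  rewrite -mulgA d_shift_x; try lia.
  by rewrite mulgA (@d_cat 2 m.+2 m.+3) ?d1 //; lia.
have C : commute (x 0) (d 2 n) by apply: d_comm'; lia.
have R : cox_prod = x 0 * d 1 n by rewrite -d1 -d_cat //; lia.
have D : d 1 n = x 1 * d 2 n by rewrite -d1 -d_cat //; lia.
have R2 : cox_prod = x 0 * x 1 * d 2 n by rewrite -mulgA -D.
have -> : x 1 * (cox_prod * cox_prod) = x 0 * x 1 * x 0 * (d 1 n * d 1 n).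
  rewrite R2 D !mulgA -(mulgA _ (d 2 n) (x 0)) -C !mulgA.
  by rewrite -x_braid4.
rewrite K {1}R2 R !mulgA -(mulgA _ (d 2 n) (x 0)) -C !mulgA //.
Qed.

Lemma rotated0 : rotated 0 = x 1.
Proof. by rewrite /rotated invg1 mulg1 mul1g. Qed.

Lemma cox_prod_rotated i : cox_prod * rotated i = rotated i.+1 * cox_prod.
Proof. by rewrite /rotated expgS invgM !mulgA mulgVK. Qed.

Lemma rotated_shift i j :
  rotated (i + j) = cox_prod ^+ i * rotated j * cox_prod ^- i.
Proof. by rewrite /rotated expgnDr invgM !mulgA. Qed.

Lemma rotated_x i : (i.+1 < n)%N -> rotated i = x i.+1.
Proof.
elim: i => [|i IH] iN; first exact: rotated0.
apply: (mulIg cox_prod); rewrite -cox_prod_rotated IH; last by lia.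
exact: cox_prod_shift.
Qed.

(** After [n - 2] turns [x 1] has become [x n.-1], and [cox_prod_square] makes
    up the last two. *)
Lemma rotated_per i : rotated (i + n) = rotated i.
Proof.
suff E : rotated n = x 1 by rewrite rotated_shift E.
apply: (mulIg (cox_prod * cox_prod)).
have E i0 : rotated (2 + i0) * (cox_prod * cox_prod) = cox_prod * cox_prod * rotated i0.
  by rewrite rotated_shift expg2 mulgVK.
have := E n.-2; rewrite addnC addn2.
have ->: n.-2.+2 = n by lia.
by move=> ->; rewrite rotated_x ?prednK ?cox_prod_square //; lia.
Qed.

Lemma rotated_braid i : (2 < n)%N ->
  rotated i * rotated i.+1 * rotated i = rotated i.+1 * rotated i * rotated i.+1.
Proof.
move=> n3; have Ei0 : rotated i = x 1 ^ (cox_prod ^- i).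
  by rewrite conjgE invgK mulgA.
have Ei1 : rotated i.+1 = x 2 ^ (cox_prod ^- i).
  by rewrite -addn1 rotated_shift rotated_x // conjgE invgK mulgA.
by rewrite Ei0 Ei1 -!conjMg x_braid3.
Qed.

Lemma rotated_comm i j : (i.+2 <= j)%N -> (j.+2 <= i + n)%N ->
  commute (rotated i) (rotated j).
Proof.
move=> ij jn; have Ei0 : rotated i = x 1 ^ (cox_prod ^- i).
  by rewrite conjgE invgK mulgA.
have Ej : rotated j = x (j - i).+1 ^ (cox_prod ^- i).
  rewrite -[in LHS](@subnKC i j) ?rotated_shift; last by lia.
  by rewrite rotated_x ?conjgE ?invgK ?mulgA //; lia.
by rewrite /commute Ei0 Ej -!conjMg x_comm //; lia.
Qed.

Lemma chord_side i : (0 < i < n)%N ->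
  chord n rotated cox_prod i.-1 i = x i.
Proof.
move=> iN; have := chord1 rotated cox_prod n_gt1 i.-1.
by rewrite !prednK; try lia; move=> ->; rewrite rotated_x prednK //; lia.
Qed.

Lemma chord_diameter : chord n rotated cox_prod 0 n = x 0.
Proof.
rewrite chordE -{2}[n]add0n cyc_full cyc_lt; last by lia.
apply: (mulIg (\prod_(0 <= p < n.-1) rotated p)); rewrite mulgVK /cox_prod.
rewrite big_ltn; last by lia.
congr (_ * _); rewrite big_add1.
rewrite big_nat [RHS]big_nat; apply: eq_bigr => p pn; rewrite rotated_x //; lia.
Qed.

End ArtinRotation.

(** * Reflections and moved spaces *)
Section ReflectionAlgebra.
Local Open Scope ring_scope.
Variables (R : realType) (n : nat).
Implicit Types (x y z v : 'cV[R]_n) (a u w : 'M[R]_n).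

Definition dot x y : R := (x^T *m y) 0 0.

Lemma dotE x y : dot x y = \sum_k x k 0 * y k 0.
Proof. by rewrite /dot mxE; apply: eq_bigr => k _; rewrite mxE. Qed.

Lemma dotC x y : dot x y = dot y x.
Proof. by rewrite !dotE; apply: eq_bigr => k _; rewrite mulrC. Qed.

Lemma dotDr x y z : dot x (y + z) = dot x y + dot x z.
Proof. by rewrite /dot mulmxDr mxE. Qed.

Lemma dotZr x c y : dot x (c *: y) = c * dot x y.
Proof. by rewrite /dot -scalemxAr mxE. Qed.

Lemma dotNr x y : dot x (- y) = - dot x y.
Proof. by rewrite /dot mulmxN mxE. Qed.

Lemma dot0r x : dot x 0 = 0.
Proof. by rewrite /dot mulmx0 mxE. Qed.

Lemma dotBr x y z : dot x (y - z) = dot x y - dot x z.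
Proof. by rewrite dotDr dotNr. Qed.

Lemma dotDl x y z : dot (x + y) z = dot x z + dot y z.
Proof. by rewrite dotC dotDr !(dotC z). Qed.

Lemma dotZl c x y : dot (c *: x) y = c * dot x y.
Proof. by rewrite dotC dotZr dotC. Qed.

Lemma dotNl x y : dot (- x) y = - dot x y.
Proof. by rewrite dotC dotNr dotC. Qed.

Lemma dotBl x y z : dot (x - y) z = dot x z - dot y z.
Proof. by rewrite dotDl dotNl. Qed.

Lemma dot_suml (I : Type) (r : seq I) (P : pred I) (F : I -> 'cV[R]_n) y :
  dot (\sum_(i <- r | P i) F i) y = \sum_(i <- r | P i) dot (F i) y.
Proof.
by apply: (big_morph (dot^~ y)) => [u v|]; rewrite ?dotDl // dotC dot0r.
Qed.

Lemma dot_eq0 x : (dot x x == 0) = (x == 0).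
Proof.
apply/eqP/eqP => [|->]; last exact: dot0r.
rewrite dotE => /psumr_eq0P H; apply/matrixP => k j; rewrite ord1 mxE.
apply/eqP; rewrite -sqrf_eq0 expr2 H // => i _.
by rewrite -expr2 sqr_ge0.
Qed.

Lemma dotM a x y : dot (a *m x) y = dot x (a^T *m y).
Proof. by rewrite /dot trmx_mul mulmxA. Qed.

Definition ortho_mat a := a^T *m a = 1%:M.

Lemma ortho_matC a : ortho_mat a -> a *m a^T = 1%:M.
Proof. exact: mulmx1C. Qed.

Lemma ortho_mat_tr a : ortho_mat a -> ortho_mat a^T.
Proof. by move=> /ortho_matC; rewrite /ortho_mat trmxK. Qed.

Lemma ortho_matM a u : ortho_mat a -> ortho_mat u -> ortho_mat (a *m u).
Proof.
move=> aO uO; rewrite /ortho_mat trmx_mul mulmxA -(mulmxA _ _ a) aO mulmx1.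
exact: uO.
Qed.

Lemma ortho_mat1 : ortho_mat 1%:M.
Proof. by rewrite /ortho_mat trmx1 mulmx1. Qed.

Lemma ortho_matK a (p : nat) (x : 'M_(n, p)) : ortho_mat a -> a^T *m (a *m x) = x.
Proof. by move=> aO; rewrite mulmxA aO mul1mx. Qed.

Lemma ortho_matKV a (p : nat) (x : 'M_(n, p)) : ortho_mat a -> a *m (a^T *m x) = x.
Proof. by move=> /ortho_matC aO; rewrite mulmxA aO mul1mx. Qed.

Lemma ortho_mat_inv a : ortho_mat a -> invmx a = a^T.
Proof.
move=> aO; have [_ au] := mulmx1_unit aO.
by rewrite -[LHS]mul1mx -aO -mulmxA mulmxV // mulmx1.
Qed.

Lemma ortho_mat_dot a x y : ortho_mat a -> dot (a *m x) (a *m y) = dot x y.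
Proof. by move=> aO; rewrite dotM ortho_matK. Qed.

Lemma ortho_mat_inj a : ortho_mat a -> injective (fun x => a *m x).
Proof. by move=> aO x y /(congr1 (mulmx a^T)); rewrite !ortho_matK. Qed.

Lemma reflectionE v x :
  reflection v *m x = x - (2 * dot v x / dot v v) *: v.
Proof.
rewrite /reflection mulmxBl mul1mx -scalemxAl -mulmxA.
have -> : v^T *m x = (dot v x)%:M by rewrite [LHS]mx11_scalar.
by rewrite mul_mx_scalar scalerA mulrAC.
Qed.

Lemma mulmx_col_eq a u : (forall x, a *m x = u *m x) -> a = u.
Proof.
move=> E; apply/matrixP => i j.
by move/matrixP/(_ i 0): (E (delta_mx j 0)); rewrite -!colE !mxE.
Qed.

Lemma reflectionZ c v : c != 0 -> reflection (c *: v) = reflection v.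
Proof.
move=> c0; apply: mulmx_col_eq => x; rewrite !reflectionE; congr (_ - _).
have [->|v0] := eqVneq v 0; first by rewrite !scaler0.
have d0 : dot v v != 0 by rewrite dot_eq0.
rewrite scalerA !(dotZl, dotZr); congr (_ *: _); field.
by rewrite c0 d0.
Qed.

Lemma reflectionN v : reflection (- v) = reflection v.
Proof. by rewrite -scaleN1r reflectionZ // oppr_eq0 oner_eq0. Qed.

Lemma reflectionBC x y : reflection (x - y) = reflection (y - x).
Proof. by rewrite -reflectionN opprB. Qed.

Lemma reflection_sym v : (reflection v)^T = reflection v.
Proof.
rewrite /reflection linearB /= trmx1 linearZ /=.
by rewrite trmx_mul trmxK.
Qed.

Lemma reflection_fix v x : dot v x = 0 -> reflection v *m x = x.
Proof. by move=> d0; rewrite reflectionE d0 mulr0 mul0r scale0r subr0. Qed.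

Lemma reflection_self v : v != 0 -> reflection v *m v = - v.
Proof.
move=> v0; rewrite reflectionE mulfK ?dot_eq0 // scaler_nat.
by rewrite mulr2n opprD addNKr.
Qed.

Lemma reflection0 : reflection 0 = 1%:M :> 'M[R]_n.
Proof. by rewrite /reflection mul0mx scaler0 subr0. Qed.

Lemma reflectionK v : reflection v *m reflection v = 1%:M.
Proof.
have [->|v0] := eqVneq v 0; first by rewrite reflection0 mulmx1.
apply: mulmx_col_eq => x; rewrite mul1mx -mulmxA [X in _ *m X]reflectionE.
rewrite mulmxBr -scalemxAr reflection_self // reflectionE scalerN opprK.
by rewrite subrK.
Qed.

Lemma reflection_ortho_mat v : ortho_mat (reflection v).
Proof. by rewrite /ortho_mat reflection_sym reflectionK. Qed.

Lemma reflectionKm v (p : nat) (x : 'M_(n, p)) :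
  reflection v *m (reflection v *m x) = x.
Proof. by rewrite mulmxA reflectionK mul1mx. Qed.

Lemma reflection_conj a v : ortho_mat a ->
  a *m reflection v *m a^T = reflection (a *m v).
Proof.
move=> aO; apply: mulmx_col_eq => x; rewrite -!mulmxA !reflectionE.
by rewrite mulmxBr ortho_matKV // -scalemxAr ortho_mat_dot // dotM.
Qed.

Lemma reflection_swap x y : dot x x = dot y y ->
  reflection (x - y) *m x = y.
Proof.
move=> dxy; have [->|xy] := eqVneq x y.
  by rewrite subrr reflection0 mul1mx.
have d0 : dot (x - y) (x - y) != 0 by rewrite dot_eq0 subr_eq0.
rewrite reflectionE.
have -> : 2 * dot (x - y) x / dot (x - y) (x - y) = 1.
  apply: (mulIf d0); rewrite mulfVK // mul1r !(dotBl, dotBr) (dotC y x) dxy.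
  by ring.
by rewrite scale1r opprB addrC subrK.
Qed.

(** The dimension of the moved space of [w]. *)
Definition rho w : nat := \rank (w - 1%:M).

Lemma rho1 : rho 1%:M = 0%N.
Proof. by rewrite /rho subrr mxrank0. Qed.

Lemma rho_eq0 w : rho w = 0%N -> w = 1%:M.
Proof. by move/eqP; rewrite /rho mxrank_eq0 subr_eq0 => /eqP. Qed.

Lemma fixE w x : ((w - 1%:M) *m x == 0) = (w *m x == x).
Proof. by rewrite mulmxBl mul1mx subr_eq0. Qed.

Lemma rho_fix_sub u w : (forall x, u *m x = x -> w *m x = x) ->
  (w - 1%:M <= u - 1%:M)%MS.
Proof.
move=> uw; rewrite submxE; apply/eqP/mulmx_col_eq => x; rewrite mul0mx.
apply/eqP; rewrite -mulmxA fixE; apply/eqP/uw/eqP.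
by rewrite -fixE mulmxA mulmx_coker mul0mx.
Qed.

Lemma rho_fix u w : (forall x, u *m x = x -> w *m x = x) ->
  (rho w <= rho u)%N.
Proof. by move/rho_fix_sub/mxrankS. Qed.

Lemma rho_fix_lt u w y : (forall x, u *m x = x -> w *m x = x) ->
  w *m y = y -> u *m y <> y -> (rho w < rho u)%N.
Proof.
move=> uw wy uy; rewrite ltnNge; apply/negP => le_uw.
have := (mxrank_leqif_sup (rho_fix_sub uw)).2.
rewrite eqn_leq le_uw rho_fix //= => /esym/submxP[D E].
apply/uy/eqP; rewrite -fixE E -mulmxA.
by move/eqP: wy; rewrite -fixE => /eqP ->; rewrite mulmx0.
Qed.

Lemma rho_full w : (forall x, w *m x = x -> x = 0) -> rho w = n.
Proof.
move=> w0; apply/eqP; rewrite eqn_leq rank_leq_row /=.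
have {1}-> : n = \rank (1%:M : 'M[R]_n) by rewrite mxrank1.
apply: mxrankS; rewrite submxE mul1mx; apply/eqP/mulmx_col_eq => x.
rewrite mul0mx; apply/w0/eqP; rewrite -fixE mulmxA mulmx_coker mul0mx //.
Qed.

Lemma rho_mul u w : (rho (u *m w) <= rho u + rho w)%N.
Proof.
have -> : rho (u *m w) = \rank ((u - 1%:M) + u *m (w - 1%:M))%R.
  by rewrite /rho mulmxBr mulmx1 [X in _ = \rank X]addrC addrA subrK.
apply: leq_trans (mxrank_add _ _) _.
by rewrite leq_add2l mxrankM_maxr.
Qed.

Lemma rho_conj a w : ortho_mat a -> rho (a *m w *m a^T) = rho w.
Proof.
move=> aO; rewrite /rho.
have -> : a *m w *m a^T - 1%:M = a *m (w - 1%:M) *m a^T.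
  by rewrite mulmxBr mulmx1 mulmxBl ortho_matC.
have [_ au] := mulmx1_unit aO; have [aTu _] := mulmx1_unit aO.
by rewrite mxrankMfree ?row_free_unit // eqmxMfull // row_full_unit.
Qed.

Lemma rhoC u w : ortho_mat u -> rho (u *m w) = rho (w *m u).
Proof.
by move=> uO; rewrite -(rho_conj (w *m u) uO) -!mulmxA ortho_matC // mulmx1.
Qed.

Lemma rho_reflection v : v != 0 -> rho (reflection v) = 1%N.
Proof.
move=> v0; have [le0|gt0] := posnP (rho (reflection v)).
  have := reflection_self v0; rewrite (rho_eq0 le0) mul1mx => /eqP.
  by rewrite -addr_eq0 -mulr2n -scaler_nat scaler_eq0 (negPf v0) pnatr_eq0.
apply/eqP; rewrite eqn_leq gt0 andbT /rho /reflection addrAC subrr sub0r.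
rewrite mxrank_opp; apply: leq_trans (mxrankS (scalemx_sub _ (submx_refl _))) _.
by apply: leq_trans (mxrankM_maxl _ _) _; exact: rank_leq_col.
Qed.

Lemma rho_reflection_ge v w :
  (rho w <= (rho (reflection v *m w)).+1)%N.
Proof.
have [->|v0] := eqVneq v 0; first by rewrite reflection0 mul1mx.
have := rho_mul (reflection v) (reflection v *m w).
by rewrite reflectionKm rho_reflection.
Qed.

(** A fixed vector of [w] is orthogonal to [v = w y - y], so it is fixed by
    [reflection v *m w] as well; and [y] is a new fixed vector, as the
    reflection exchanges [w y] and [y]. *)
Lemma rho_moved v w y : ortho_mat w -> v != 0 -> v = w *m y - y ->
  (rho (reflection v *m w)).+1 = rho w.
Proof.
move=> wO v0 vE; apply/eqP; rewrite eqn_leq rho_reflection_ge andbT.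
apply: (@rho_fix_lt _ _ y) => [x wx||wy].
- rewrite -mulmxA wx reflection_fix // vE dotBl -{1}wx ortho_mat_dot //.
  by rewrite subrr.
- by rewrite -mulmxA vE reflection_swap // ortho_mat_dot.
by move: v0; rewrite vE wy subrr eqxx.
Qed.

(** Otherwise [w] would fix every fixed vector [z] of [reflection v *m w]:
    [w z] and [z] have the same product with [x] and differ by a multiple of
    [v], which is not orthogonal to [x]. *)
Lemma rho_moved_fix v w x : ortho_mat w ->
  (rho (reflection v *m w)).+1 = rho w -> w *m x = x -> dot v x = 0.
Proof.
move=> wO rw wx; apply/eqP/negP => /negP vx.
have v0 : v != 0 by apply: contraNneq vx => ->; rewrite dotC dot0r.
suff : (rho w <= rho (reflection v *m w))%N by rewrite -rw ltnn.
apply: rho_fix => z; rewrite -mulmxA => /(congr1 (mulmx (reflection v))).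
rewrite reflectionKm => wz.
have : dot x (w *m z) = dot x z by rewrite -{1}wx ortho_mat_dot.
rewrite wz reflectionE dotBr dotZr => /eqP.
rewrite subr_eq addrC -subr_eq subrr eq_sym mulf_eq0 (dotC x) (negPf vx) orbF.
rewrite mulf_eq0 invr_eq0 dot_eq0 (negPf v0) orbF => /eqP ->.
by rewrite mul0r scale0r subr0.
Qed.

End ReflectionAlgebra.

(** * The group of the cube and its reflection length *)
Section SignedBasis.
Local Open Scope ring_scope.
Variables (R : realType) (n : nat).
Implicit Types (x y z v : 'cV[R]_n) (a u w : 'M[R]_n).

Local Notation W := (@group_C R n).

Definition unitv (k : 'I_n) : 'cV[R]_n := delta_mx k 0.

Definition signed x := exists k, x = unitv k \/ x = - unitv k.

Lemma unitvE k i : unitv k i 0 = (i == k)%:R.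
Proof. by rewrite mxE eqxx andbT. Qed.

Lemma dot_unitv x k : dot (unitv k) x = x k 0.
Proof.
rewrite dotE (bigD1 k) //= unitvE eqxx mul1r big1 ?addr0 // => i ik.
by rewrite unitvE (negPf ik) mul0r.
Qed.

Lemma signed_unitv k : signed (unitv k).
Proof. by exists k; left. Qed.

Lemma signedN x : signed x -> signed (- x).
Proof. by case=> k [->|->]; exists k; [right|left; rewrite opprK]. Qed.

Lemma signed_dot1 x : signed x -> dot x x = 1.
Proof.
by case=> k [->|->]; rewrite ?dotNl ?dotNr ?opprK dot_unitv unitvE eqxx.
Qed.

Lemma signed_neq0 x : signed x -> x != 0.
Proof. by move/signed_dot1 => x1; rewrite -dot_eq0 x1 oner_eq0. Qed.

Lemma signed_neqN x : signed x -> x != - x.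
Proof.
move=> /signed_neq0; apply: contraNneq => /eqP.
by rewrite -addr_eq0 -mulr2n -scaler_nat scaler_eq0 pnatr_eq0.
Qed.

Lemma signed_dot x y : signed x -> signed y ->
  [\/ x = y, x = - y | dot x y = 0].
Proof.
have D k l : k != l -> dot (unitv k) (unitv l) = 0.
  by move=> kl; rewrite dot_unitv unitvE (negPf kl).
case=> k xk [l yl]; have [kl|kl] := eqVneq k l.
  rewrite -{l}kl in yl; case: xk yl => -> [->|->]; rewrite ?opprK;
  by [constructor 1|constructor 2].
by constructor 3; case: xk yl => -> [->|->]; rewrite ?dotNl ?dotNr D ?oppr0.
Qed.

Lemma signed_dot_gt0 x y : signed x -> signed y -> 0 < dot x y -> x = y.
Proof.
move=> sx sy; case: (signed_dot sx sy) => [//|->|->]; last by rewrite ltxx.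
by rewrite dotNl signed_dot1 // oppr_gt0 ltr10.
Qed.

(** The entries can only be 0, 1 and -1, and the length leaves room for one that
    is not 0. *)
Lemma signed_entries x : dot x x = 1 ->
  (forall i, `|x i 0| = `|x i 0| ^+ 2) -> signed x.
Proof.
move=> x1 xi; have [k xk] : exists k, x k 0 != 0.
  apply/existsP; apply: contraPT x1 => /existsPn x0.
  rewrite dotE big1 => [/esym/eqP|i _]; first by rewrite oner_eq0.
  by move: (x0 i); rewrite negbK => /eqP ->; rewrite mul0r.
have sq i : x i 0 * x i 0 = `|x i 0| by rewrite xi real_normK ?expr2 ?num_real.
have ak : `|x k 0| = 1.
  have n0 : `|x k 0| != 0 by rewrite normr_eq0.
  by apply: (mulfI n0); rewrite mulr1 -expr2 -xi.
have x0 i : i != k -> x i 0 = 0.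
  move=> ik; move: x1; rewrite dotE (bigD1 k) //= sq ak => /eqP.
  rewrite -subr_eq0 addrAC subrr add0r psumr_eq0 => [/allP H|j _]; last first.
    by rewrite sq.
  have := H i (mem_index_enum i); rewrite ik /= sq normr_eq0 => /eqP //.
exists k; have: (x k 0 == 1) || (x k 0 == -1).
  by rewrite -sqrf_eq1 expr2 sq ak.
by case/orP => /eqP E; [left|right]; apply/matrixP => i j; rewrite ord1;
  have [->|ik] := eqVneq i k; rewrite ?mxE ?eqxx ?E // x0 // (negPf ik) ?oppr0.
Qed.

Lemma group_C_ortho_mat a : W a -> ortho_mat a.
Proof. by case. Qed.

Lemma cube_col_sg (r : 'I_n -> R) : cube (\col_k Num.sg (r k)).
Proof. by move=> i; rewrite mxE -ler_norml normr_sg lern1; case: eqP. Qed.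

(** Let [r] be a row of [a]. It is a unit vector, and the image of the vertex
    of the cube given by the signs of [r] shows that the absolute values in [r]
    have sum at most 1. So the terms [`|r_j| - `|r_j| ^+ 2], all nonnegative,
    have sum at most 0. *)
Lemma group_C_entry a l k : W a -> `|a l k| = `|a l k| ^+ 2.
Proof.
move=> [aO aC]; have aOC := ortho_matC aO.
have sq j : `|a l j| ^+ 2 = a l j * a l j by rewrite real_normK ?expr2 ?num_real.
have s1 : \sum_j `|a l j| ^+ 2 = 1.
  move/matrixP/(_ l l): aOC; rewrite !mxE eqxx mulr1n => <-.
  by apply: eq_bigr => j _; rewrite mxE sq.
have s2 : \sum_j `|a l j| <= 1.
  have : cube (a *m \col_j Num.sg (a l j)).
    by rewrite -aC; exists (\col_j Num.sg (a l j)) => //; exact: cube_col_sg.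
  move/(_ l)/andP => [_]; rewrite mxE; congr (_ <= _).
  by apply: eq_bigr => j _; rewrite mxE [RHS]normrEsg mulrC.
have le1 j : `|a l j| <= 1.
  rewrite -(@ler_pXn2r _ 2) ?nnegrE ?ler01 // expr1n -s1 (bigD1 j) //=.
  by rewrite lerDl sumr_ge0 // => i _; rewrite sqr_ge0.
have ge0 j : 0 <= `|a l j| - `|a l j| ^+ 2.
  by rewrite subr_ge0 expr2 ler_piMr.
have : \sum_j (`|a l j| - `|a l j| ^+ 2) == 0.
  by rewrite eq_le sumr_ge0 // andbT sumrB s1 subr_le0.
rewrite psumr_eq0 // => /allP /(_ k (mem_index_enum k)) /=.
by rewrite subr_eq0 => /eqP.
Qed.

Lemma mulmx_unitv a k i : (a *m unitv k) i 0 = a i k.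
Proof. by rewrite -colE mxE. Qed.

Lemma group_C_signed a x : W a -> signed x -> signed (a *m x).
Proof.
move=> aW; have aO := group_C_ortho_mat aW.
have ak k : signed (a *m unitv k).
  apply: signed_entries.
    by rewrite ortho_mat_dot // signed_dot1 //; exact: signed_unitv.
  by move=> i; rewrite mulmx_unitv; exact: group_C_entry.
by case=> k [->|->]; rewrite ?mulmxN //; exact: signedN.
Qed.

Lemma signed_tr a x : ortho_mat a -> (forall k, signed (a *m unitv k)) ->
  signed x -> signed (a^T *m x).
Proof.
move=> aO aS; have aTO := ortho_mat_tr aO.
suff ak k : signed (a^T *m unitv k).
  by case=> k [->|->]; rewrite ?mulmxN //; exact: signedN.
apply: signed_entries.
  by rewrite ortho_mat_dot // signed_dot1 //; exact: signed_unitv.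
move=> i; rewrite mulmx_unitv mxE -mulmx_unitv -dot_unitv.
case: (signed_dot (signed_unitv k) (aS i)) => [->|->|->].
- by rewrite signed_dot1 // normr1 expr1n.
- by rewrite dotNl signed_dot1 // normrN normr1 expr1n.
by rewrite normr0 expr0n.
Qed.

(** The coordinates of [a *m x] are those of [x] up to order and signs. *)
Lemma signed_cube a x : ortho_mat a -> (forall k, signed (a *m unitv k)) ->
  cube x -> cube (a *m x).
Proof.
move=> aO aS xC i; rewrite -dot_unitv dotC dotM dotC.
case: (signed_tr aO aS (signed_unitv i)) => k [->|->].
  by rewrite dot_unitv; exact: xC.
by rewrite dotNl dot_unitv lerNl opprK lerNl andbC; exact: xC.
Qed.

Lemma group_C_intro a : ortho_mat a -> (forall k, signed (a *m unitv k)) ->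
  W a.
Proof.
move=> aO aS; split=> //; apply/seteqP; split=> x.
  by case=> y yC <-; exact: signed_cube.
move=> xC; exists (a^T *m x); last by rewrite ortho_matKV.
apply: signed_cube => //; first exact: ortho_mat_tr.
by move=> k; apply: signed_tr => //; exact: signed_unitv.
Qed.

Lemma group_C1 : W (1%:M : 'M[R]_n).
Proof.
apply: group_C_intro; first exact: ortho_mat1.
by move=> k; rewrite mul1mx; exact: signed_unitv.
Qed.

Lemma group_CM a u : W a -> W u -> W (a *m u).
Proof.
move=> aW uW; apply: group_C_intro.
  by apply: ortho_matM; exact: group_C_ortho_mat.
by move=> k; rewrite -mulmxA; do 2!apply: group_C_signed => //; exact: signed_unitv.
Qed.

Lemma group_C_tr a : W a -> W a^T.
Proof.
move=> aW; have aO := group_C_ortho_mat aW.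
apply: group_C_intro; first exact: ortho_mat_tr.
move=> k; apply: signed_tr => // [l|]; last exact: signed_unitv.
by apply: group_C_signed => //; exact: signed_unitv.
Qed.

Lemma signed_reflection_act x y z : signed x -> signed y -> signed z ->
  [/\ z <> x, z <> - x, z <> y & z <> - y] -> reflection (x - y) *m z = z.
Proof.
move=> sx sy sz [zx zNx zy zNy]; apply: reflection_fix; rewrite dotC dotBr.
case: (signed_dot sz sx) => [//|//|->]; case: (signed_dot sz sy) => [//|//|->].
by rewrite subrr.
Qed.

Lemma signed_reflection_swap x y : signed x -> signed y ->
  reflection (x - y) *m x = y.
Proof. by move=> sx sy; apply: reflection_swap; rewrite !signed_dot1. Qed.

Lemma group_C_reflection x y : signed x -> signed y ->
  W (reflection (x - y)).
Proof.
move=> sx sy; apply: group_C_intro; first exact: reflection_ortho_mat.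
move=> k; have sk := signed_unitv k.
have Ex : reflection (x - y) *m x = y by exact: signed_reflection_swap.
have Ey : reflection (x - y) *m y = x.
  by rewrite reflectionBC signed_reflection_swap.
have [->|/eqP kx] := eqVneq (unitv k) x; first by rewrite Ex.
have [->|/eqP ky] := eqVneq (unitv k) y; first by rewrite Ey.
have [->|/eqP kNx] := eqVneq (unitv k) (- x).
  by rewrite mulmxN Ex; exact: signedN.
have [->|/eqP kNy] := eqVneq (unitv k) (- y).
  by rewrite mulmxN Ey; exact: signedN.
by rewrite signed_reflection_act.
Qed.

Lemma is_reflection_signed x y : signed x -> signed y -> x != y ->
  is_reflection W (reflection (x - y)).
Proof.
move=> sx sy xy; exists (x - y) => //; split; first by rewrite subr_eq0.
exact: group_C_reflection.
Qed.

(** For any basis vector [e] not orthogonal to [v], the vector [v] is a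
    multiple of [e - reflection v e]. *)
Lemma root_signed v : is_root W v ->
  exists x y, [/\ signed x, signed y, x != y &
    exists2 c, c != 0 & v = c *: (x - y)].
Proof.
case=> v0 vW; have [k vk] : exists k, v k 0 != 0.
  apply/existsP; apply: contraNT v0 => /existsPn v0.
  apply/eqP/matrixP => i j; rewrite ord1 mxE; apply/eqP.
  by move: (v0 i); rewrite negbK.
exists (unitv k), (reflection v *m unitv k).
have d0 : dot v v != 0 by rewrite dot_eq0.
have E : unitv k - reflection v *m unitv k = (2 * v k 0 / dot v v) *: v.
  by rewrite reflectionE dotC dot_unitv opprB addrC subrK.
have c0 : 2 * v k 0 / dot v v != 0.
  by rewrite !mulf_neq0 ?invr_eq0 // pnatr_eq0.
split; [exact: signed_unitv| |by rewrite -subr_eq0 E scaler_eq0 negb_or c0|].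
  by apply: group_C_signed => //; exact: signed_unitv.
by exists (2 * v k 0 / dot v v)^-1; rewrite ?invr_eq0 // E scalerA mulVf ?scale1r.
Qed.

Lemma reflection_signedP w : is_reflection W w ->
  exists x y, [/\ signed x, signed y, x != y & w = reflection (x - y)].
Proof.
case=> v /root_signed[x [y [sx sy xy [c c0 ->]]]] ->.
by exists x, y; split=> //; rewrite reflectionZ.
Qed.

Lemma group_C_is_reflection w : is_reflection W w -> W w.
Proof. by case=> v [_ vW] ->. Qed.

Lemma is_reflection_tr w : is_reflection W w -> w^T = w.
Proof. by case=> v _ ->; exact: reflection_sym. Qed.

Lemma is_reflectionK w : is_reflection W w -> w *m w = 1%:M.
Proof. by case=> v _ ->; exact: reflectionK. Qed.

Lemma is_reflection_rho w : is_reflection W w -> rho w = 1%N.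
Proof. by case=> v [v0 _] ->; exact: rho_reflection. Qed.

Lemma is_reflection_conj a w : W a -> is_reflection W w ->
  is_reflection W (a *m w *m a^T).
Proof.
move=> aW /reflection_signedP[x [y [sx sy xy ->]]].
have aO := group_C_ortho_mat aW.
rewrite reflection_conj // mulmxBr; apply: is_reflection_signed.
- exact: group_C_signed.
- exact: group_C_signed.
by apply: contraNneq xy => /(ortho_mat_inj aO) ->.
Qed.

Definition mulmxs (r : seq 'M[R]_n) : 'M[R]_n := foldr mulmx 1%:M r.

Lemma mulmxs_cat r r' : mulmxs (r ++ r') = mulmxs r *m mulmxs r'.
Proof. by elim: r => [|t r IH] /=; rewrite ?mul1mx // IH mulmxA. Qed.

Definition refls (r : seq 'M[R]_n) :=
  forall t, t \in r -> is_reflection W t.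

Lemma refls_cons t r :
  refls (t :: r) <-> is_reflection W t /\ refls r.
Proof.
split=> [H|[Ht Hr] u].
  by split=> [|u ur]; apply: H; rewrite inE ?eqxx // ur orbT.
by rewrite inE => /predU1P[->|/Hr].
Qed.

Lemma refls_cat r r' : refls r -> refls r' -> refls (r ++ r').
Proof. by move=> H H' t; rewrite mem_cat => /orP[/H|/H']. Qed.

Lemma refls_group_C r : refls r -> W (mulmxs r).
Proof.
elim: r => [|t r IH] /= => [_|/refls_cons[tR rR]]; first exact: group_C1.
by apply: group_CM; [exact: group_C_is_reflection|exact: IH].
Qed.

Lemma rho_mulmxs r : refls r -> (rho (mulmxs r) <= size r)%N.
Proof.
elim: r => [|t r IH] /= => [_|/refls_cons[tR rR]]; first by rewrite rho1.
by apply: leq_trans (rho_mul _ _) _; rewrite is_reflection_rho // add1n ltnS IH.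
Qed.

(** A non-identity element of [group_C] moves some signed basis vector [x] to
    another, and the reflection swapping the two lowers the rank. *)
Lemma group_C_descent w : W w -> w <> 1%:M ->
  exists2 t, is_reflection W t & (rho (t *m w)).+1 = rho w.
Proof.
move=> wW w1; have [k wk] : exists k, w *m unitv k != unitv k.
  apply/existsP; apply: contra_notT w1 => /existsPn wk.
  apply/matrixP => i j; rewrite -mulmx_unitv; move: (wk j).
  by rewrite negbK => /eqP ->; rewrite unitvE mxE.
have sk := signed_unitv k; have swk := group_C_signed wW sk.
exists (reflection (w *m unitv k - unitv k)); first exact: is_reflection_signed.
apply: (rho_moved (y := unitv k)) => //; first exact: group_C_ortho_mat.
by rewrite subr_eq0.
Qed.

Lemma reduced_word_ex w : W w ->
  exists r, [/\ refls r, mulmxs r = w & size r = rho w].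
Proof.
move: {2}(rho w) (erefl (rho w)) => k; elim: k w => [|k IH] w wk wW.
  by exists [::]; rewrite (rho_eq0 wk) rho1.
have [|t tR tw] := @group_C_descent w wW; first by move=> E; rewrite E rho1 in wk.
have tW := group_C_is_reflection tR.
have [||r [rR rE rk]] := IH (t *m w); [lia|exact: group_CM|].
exists (t :: r); split=> /=; first by apply/refls_cons.
  by rewrite rE mulmxA is_reflectionK // mul1mx.
by rewrite rk tw.
Qed.

Lemma big_mulmxs m (F : 'I_m -> 'M[R]_n) :
  \big[mulmx/1%:M]_(i < m) F i = mulmxs [seq F i | i <- enum 'I_m].
Proof.
by rewrite /mulmxs foldr_map unlock /reducebig /index_enum /= -enumT.
Qed.

Lemma refl_productP w k : refl_product W w k <->
  exists r, [/\ refls r, mulmxs r = w & size r = k].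
Proof.
split=> [[r rR ->]|[r [rR <- <-]]].
  exists [seq r i | i <- enum 'I_k]; split; last by rewrite size_map size_enum_ord.
    by move=> t /mapP[i _ ->].
  exact/esym/big_mulmxs.
exists (fun i : 'I_(size r) => nth 1%:M r i) => [i|].
  by apply: rR; rewrite mem_nth.
elim: r rR => [|t r IH] rR; first by rewrite big_ord0.
rewrite big_ord_recl /= -IH //.
by move=> u ur; apply: rR; rewrite inE ur orbT.
Qed.

(** A reflection has rank 1 and rank is subadditive, which bounds the length
    from below; [group_C_descent] produces a word of that length. *)
Lemma refl_lengthE w : W w -> refl_length W w = rho w.
Proof.
move=> wW; have [r [rR rE rk]] := reduced_word_ex wW.
rewrite /refl_length; case: pselect => [wk|[]]; last first.
  by exists (rho w); apply/refl_productP; exists r.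
case: ex_minnP => m /asboolP/refl_productP[r' [r'R r'E <-]] m_min.
apply/eqP; rewrite eqn_leq -{2}r'E rho_mulmxs // andbT.
by apply: m_min; apply/asboolP/refl_productP; exists r.
Qed.

Lemma refl_leE u w : W u -> W w ->
  refl_le W u w <-> (rho u + rho (u^T *m w))%N = rho w.
Proof.
move=> uW wW; rewrite /refl_le ortho_mat_inv; last exact: group_C_ortho_mat.
rewrite !refl_lengthE //; first by split=> ->.
by apply: group_CM => //; exact: group_C_tr.
Qed.

End SignedBasis.

(** * Orbits of signed basis vectors *)
Section Orbits.
Local Open Scope ring_scope.
Variables (R : realType) (n : nat).
Implicit Types (x y z v : 'cV[R]_n) (a u w t : 'M[R]_n).

Local Notation W := (@group_C R n).

Definition orb w x y := exists m, iter m (mulmx w) x = y.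

Lemma orb_refl w x : orb w x x. Proof. by exists 0%N. Qed.

Lemma orb1 w x : orb w x (w *m x). Proof. by exists 1%N. Qed.

Lemma orb_trans w y x z : orb w x y -> orb w y z -> orb w x z.
Proof. by move=> [i <-] [j <-]; exists (j + i)%N; rewrite iterD. Qed.

Lemma iter_mulmxN w m x : iter m (mulmx w) (- x) = - iter m (mulmx w) x.
Proof. by elim: m => //= m ->; rewrite mulmxN. Qed.

Lemma iter_signed w x m : W w -> signed x -> signed (iter m (mulmx w) x).
Proof. by move=> wW sx; elim: m => //= m IH; exact: group_C_signed. Qed.

(** A code in a finite type, for the pigeonhole principle. *)
Definition signed_code x : option ('I_n * bool) :=
  [pick p : 'I_n * bool | (if p.2 then unitv R p.1 else - unitv R p.1) == x].

Lemma signed_code_inj x y : signed x -> signed_code x = signed_code y -> x = y.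
Proof.
move=> sx; rewrite /signed_code; case: pickP => [p /eqP <-|no _].
  by case: pickP => // q /eqP <- [->].
by case: sx => k [E|E]; [have := no (k, true)|have := no (k, false)];
  rewrite /= E eqxx.
Qed.

Lemma signed_period w x : W w -> signed x ->
  exists2 N, (0 < N)%N & iter N (mulmx w) x = x.
Proof.
move=> wW sx; pose T := option ('I_n * bool).
pose f (i : 'I_(#|{: T}|.+1)) : T := signed_code (iter i (mulmx w) x).
have /injectivePn[i [j ij fij]] : ~~ injectiveb f.
  by apply/negP => /injectiveP /leq_card; rewrite card_ord ltnn.
wlog lt_ij : i j ij fij / (i < j)%N.
  move=> H; case: (ltngtP i j) => [|ji|/val_inj E]; first exact: H.
    by apply: (H j i) => //; rewrite eq_sym.
  by rewrite E eqxx in ij.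
exists (j - i)%N; first by lia.
have /signed_code_inj E := fij; have {}E := E (iter_signed _ wW sx).
have wO := group_C_ortho_mat wW.
have inj m : injective (iter m (mulmx w) : 'cV_n -> 'cV_n).
  elim: m => // m IH y z /= Eyz; apply: IH; exact: (ortho_mat_inj wO Eyz).
by apply: (inj i); rewrite -iterD subnKC // ltnW.
Qed.

Lemma orb_sym w x y : W w -> signed x -> orb w x y -> orb w y x.
Proof.
move=> wW sx [m <-]; have [N N0 xN] := signed_period wW sx.
have xNm k : iter (k * N) (mulmx w) x = x.
  by elim: k => // k IH; rewrite mulSn iterD IH.
exists (m * N - m)%N; rewrite -iterD subnK ?xNm //; nia.
Qed.

Lemma iter_sum_fix w x N : (0 < N)%N -> iter N (mulmx w) x = x ->
  w *m (\sum_(0 <= m < N) iter m (mulmx w) x) =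
  \sum_(0 <= m < N) iter m (mulmx w) x.
Proof.
case: N => // N _ xN; rewrite mulmx_sumr.
rewrite [RHS]big_nat_recl // [LHS]big_nat_recr //= addrC; congr (_ + _).
exact: xN.
Qed.

Lemma iter_sub_moved w m x :
  exists z, iter m (mulmx w) x - x = w *m z - z.
Proof.
elim: m => [|m [z IH]]; first by exists 0; rewrite mulmx0 !subrr.
exists (z + iter m (mulmx w) x); rewrite mulmxDr /= opprD addrACA -IH.
by rewrite addrC addrA subrK.
Qed.

(** The difference [y - x] is of the form [w z - z], with [z] a partial sum of
    the orbit. *)
Lemma orb_rho w x y : W w -> x != y -> orb w x y ->
  (rho (reflection (x - y) *m w)).+1 = rho w.
Proof.
move=> wW xy [m yE]; have [z zE] := iter_sub_moved w m x; rewrite yE in zE.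
rewrite reflectionBC; apply: (rho_moved (y := z)) => //.
  exact: group_C_ortho_mat.
by rewrite subr_eq0 eq_sym.
Qed.

(** The sum of the [w]-orbit of [x] is fixed by [w], and pairs positively with
    [x] unless the orbit contains [- x]; so it detects membership. *)
Lemma orb_detect w x y : W w -> signed x -> signed y -> ~ orb w x (- x) ->
  (forall z, w *m z = z -> dot (x - y) z = 0) -> orb w x y.
Proof.
move=> wW sx sy xNx H; have [N N0 xN] := signed_period wW sx.
pose z := \sum_(0 <= m < N) iter m (mulmx w) x.
have wz : w *m z = z by exact: iter_sum_fix.
have nonneg m : 0 <= dot (iter m (mulmx w) x) x.
  case: (signed_dot (iter_signed m wW sx) sx) => E.
  - by rewrite E signed_dot1 // ler01.
  - by case: xNx; exists m.
  - by rewrite E.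
have zx : 0 < dot z x.
  rewrite /z dot_suml big_ltn //= signed_dot1 //.
  by rewrite ltr_wpDr ?ltr01 // sumr_ge0.
have {H} : dot (x - y) z = 0 by exact: H.
rewrite dotBl !(dotC _ z) => /eqP; rewrite subr_eq0 => /eqP E.
have {}zx : 0 < dot z y by rewrite -E.
rewrite {wz E}/z dot_suml in zx.
have [m Em] : exists m, 0 < dot (iter m (mulmx w) x) y.
  apply: contrapT => /forallNP no; move: zx; apply/negP; rewrite -leNgt.
  by apply: sumr_le0 => m _; rewrite leNgt; apply/negP/no.
by exists m; apply: signed_dot_gt0 Em => //; exact: iter_signed.
Qed.

Lemma rho_leq_below w u g : ortho_mat w ->
  (rho (u *m g) <= rho (u *m w) + rho (w^T *m g))%N.
Proof.
move=> wO; have {1}-> : u *m g = (u *m w) *m (w^T *m g).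
  by rewrite -mulmxA ortho_matKV.
exact: rho_mul.
Qed.

End Orbits.

(** * Hurwitz transitivity *)
Section Hurwitz.
Local Open Scope ring_scope.
Variables (R : realType) (n : nat) (g : 'M[R]_n).
Implicit Types (x y z v : 'cV[R]_n) (a u w t : 'M[R]_n).

Local Notation W := (@group_C R n).
Local Notation refl := (is_reflection W).
Local Notation T x y := (reflection (x - y)).

(** The order of reflection lengths in terms of ranks; [u^T] is the inverse of
    an orthogonal matrix. *)
Definition wle u w := (rho u + rho (u^T *m w) = rho w)%N.

Lemma wle_reflection t w : refl t -> wle t w <-> (rho (t *m w)).+1 = rho w.
Proof.
by move=> tR; rewrite /wle is_reflection_tr // is_reflection_rho // add1n.
Qed.

(** Hurwitz transitivity does not hold without a condition of this kind: in
    dimension two, [-1] is the product of the two sign changes and also of the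
    exchanges of [x] with [y] and of [x] with [- y]. Both pairs commute, so
    Hurwitz moves do not lead from one to the other. *)
Hypothesis no_two_sign_changes : forall x y, signed x -> signed y ->
  (rho (T y (- y) *m (T x (- x) *m g))).+2 <> rho g.

Lemma wle_suffix t w : W w -> refl t -> wle w g ->
  (rho (t *m w)).+1 = rho w -> wle (t *m w) g.
Proof.
move=> wW tR wg tw; have tO := group_C_ortho_mat (group_C_is_reflection tR).
have wO := group_C_ortho_mat wW; rewrite /wle in wg *.
have := rho_leq_below ((t *m w)^T) g wO.
rewrite trmx_mul (is_reflection_tr tR).
have -> : rho (w^T *m t *m w) = 1%N.
  rewrite -{2}[w]trmxK rho_conj ?is_reflection_rho //.
  exact: ortho_mat_tr.
have := rho_mul (t *m w) (w^T *m t *m g).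
have -> : (t *m w) *m (w^T *m t *m g) = g.
  by rewrite -!mulmxA ortho_matKV // mulmxA is_reflectionK // mul1mx.
move: wg tw; move: (rho w) (rho g) (rho (t *m w)) (rho (w^T *m g))
  (rho (w^T *m t *m g)); lia.
Qed.

(** A pair of letters split off from [w] splits off from [g = w (w^T g)]. *)
Lemma wle_pair t t' w : W w -> refl t -> refl t' -> wle w g ->
  (rho (t' *m (t *m w))).+2 = rho w -> (rho (t' *m (t *m g))).+2 = rho g.
Proof.
move=> wW tR t'R wg tw.
have wO := group_C_ortho_mat wW; rewrite /wle in wg.
have := rho_leq_below (t' *m t) g wO; rewrite -!mulmxA.
case/reflection_signedP: tR => x [y [_ _ _ tE]].
case/reflection_signedP: t'R => x' [y' [_ _ _ t'E]].
have := rho_reflection_ge (x - y) g; rewrite -tE.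
have := rho_reflection_ge (x' - y') (t *m g); rewrite -t'E.
lia.
Qed.

(** If the orbit of [x] or that of [y] does not contain its opposite, then
    [orb_detect] applies. If both do and they are different, the sign changes
    of [x] and of [y] form a pair below [w], hence below [g]. *)
Lemma rho_orb w x y : W w -> wle w g -> signed x -> signed y -> x != y ->
  (rho (T x y *m w)).+1 = rho w -> orb w x y.
Proof.
move=> wW wg sx sy xy txy.
have wO := group_C_ortho_mat wW.
have H z : w *m z = z -> dot (x - y) z = 0 by apply: rho_moved_fix.
have H' z : w *m z = z -> dot (y - x) z = 0.
  by move/H => E; rewrite -opprB dotNl E oppr0.
have [xNx|] := pselect (orb w x (- x)); last first.
  by move=> xNx; exact: (orb_detect wW sx sy).
have [yNy|] := pselect (orb w y (- y)); last first.
  by move=> yNy; have := orb_detect wW sy sx yNy H'; exact: orb_sym.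
apply: contrapT => nxy; apply: (no_two_sign_changes sx sy).
have sNx := signedN sx; have sNy := signedN sy.
have txR := is_reflection_signed sx sNx (signed_neqN sx).
have tyR := is_reflection_signed sy sNy (signed_neqN sy).
have txw := orb_rho wW (signed_neqN sx) xNx.
apply: (wle_pair wW) => //; rewrite -txw orb_rho ?signed_neqN //.
  by apply: group_CM => //; exact: group_C_is_reflection.
have same m : iter m (mulmx (T x (- x) *m w)) y = iter m (mulmx w) y.
  elim: m => //= m ->; rewrite -mulmxA; apply: signed_reflection_act => //.
    by apply: group_C_signed => //; exact: iter_signed.
  have ym : orb w y (w *m iter m (mulmx w) y) by exists m.+1.
  have yx : ~ orb w y x by move/(orb_sym wW sy).
  have yNx : ~ orb w y (- x).
    by move/(orb_sym wW sy) => xy'; apply: nxy; exact: orb_trans xy'.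
  by split=> E; rewrite E ?opprK in ym.
by case: yNy => m; rewrite -same => mE; exists m.
Qed.

Variables (A : groupType) (L : 'M[R]_n -> A).
Hypothesis L_pair : forall t t', refl t -> refl t' ->
  (rho (t' *m (t *m g))).+2 = rho g ->
  (L t * L t')%g = (L t' * L (t' *m t *m t'))%g.

Definition Lword (r : seq 'M[R]_n) : A := (\prod_(t <- r) L t)%g.

(** A choice of a reduced factorisation; outside of the group there is none and
    the empty word stands in. *)
Definition rword w : seq 'M[R]_n :=
  if pselect (exists r, [/\ refls r, mulmxs r = w & size r = rho w])
    is left wr then projT1 (cid wr) else [::].

Lemma rwordP w : W w ->
  [/\ refls (rword w), mulmxs (rword w) = w & size (rword w) = rho w].
Proof.
move/reduced_word_ex; rewrite /rword; case: pselect => // wr _.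
by case: cid.
Qed.

(** Once the value of [L] on the reduced words of smaller rank is known to
    depend on their product only, this is the value on every reduced word of
    [w] with first letter [t]. *)
Definition Lhead w t : A := (L t * Lword (rword (t *m w)))%g.

Section Step.
Variable w : 'M[R]_n.
Hypotheses (wW : W w) (wg : wle w g).
Hypothesis IH : forall u, W u -> wle u g -> (rho u < rho w)%N ->
  forall r, refls r -> mulmxs r = u -> size r = rho u ->
  Lword r = Lword (rword u).

Lemma Lhead_word t s : refls (t :: s) -> mulmxs (t :: s) = w ->
  size (t :: s) = rho w -> Lword (t :: s) = Lhead w t.
Proof.
move=> /refls_cons[tR sR] /= tsE ts.
have sE : mulmxs s = t *m w by rewrite -tsE mulmxA is_reflectionK // mul1mx.
have := rho_mulmxs sR; rewrite sE => les.
case/reflection_signedP: (tR) => x [y [_ _ _ tE]].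
have := rho_reflection_ge (x - y) w; rewrite -tE => lew.
have tw : (rho (t *m w)).+1 = rho w by lia.
rewrite /Lword big_cons; congr (_ * _)%g; apply: IH => //; last by lia.
- by apply: group_CM => //; exact: group_C_is_reflection.
- exact: wle_suffix.
by rewrite -tw.
Qed.

(** With [s] a reduced word of [t' t w], both [t, t', s] and
    [t', t' t t', s] are reduced words of [w]. *)
Lemma Lhead_compat t t' : refl t -> refl t' ->
  (rho (t' *m (t *m w))).+2 = rho w -> Lhead w t = Lhead w t'.
Proof.
move=> tR t'R tt'; have tW := group_C_is_reflection tR.
have t'W := group_C_is_reflection t'R.
have [|sR sE ss] := @rwordP (t' *m (t *m w)).
  by do 2!apply: group_CM => //.
set s := rword _ in sR sE ss.
have t1R : refl (t' *m t *m t').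
  by rewrite -{2}(is_reflection_tr t'R); exact: is_reflection_conj.
rewrite -(@Lhead_word t (t' :: s)); last first.
- by rewrite /= ss.
- by rewrite /= sE 2!mulmxA -(mulmxA t) is_reflectionK // mulmx1
     mulmxA is_reflectionK // mul1mx.
- by apply/refls_cons; split=> //; apply/refls_cons.
rewrite -(@Lhead_word t' ((t' *m t *m t') :: s)); last first.
- by rewrite /= ss.
- rewrite /= sE !mulmxA is_reflectionK // mul1mx -(mulmxA t).
  by rewrite is_reflectionK // mulmx1 is_reflectionK // mul1mx.
- by apply/refls_cons; split=> //; apply/refls_cons.
rewrite /Lword !big_cons !mulgA; congr (_ * _)%g.
by apply: L_pair => //; exact: (wle_pair wW).
Qed.

(** It remains to connect any two reflections below [w] by a chain of pairs as
    in [Lhead_compat]. Such a reflection exchanges two vectors of one orbit of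
    [w]. The chains lead from the swap of [x] and [y] to that of [x] and [w x]
    ([V_orb]), from there along the orbit ([V_adj]), and from one orbit to
    another ([V_far]). *)
Let V x y := Lhead w (T x y).

Let VC x y : V x y = V y x. Proof. by rewrite /V reflectionBC. Qed.

Let VN x y : V (- x) (- y) = V x y.
Proof. by rewrite /V -opprD reflectionN. Qed.

Let inj x y : w *m x = w *m y -> x = y.
Proof. by move=> E; exact: (ortho_mat_inj (group_C_ortho_mat wW) E). Qed.

Let sw x : signed x -> signed (w *m x).
Proof. exact: group_C_signed. Qed.

Let refl_ne x y : signed x -> signed y -> x <> y -> refl (T x y).
Proof. by move=> sx sy /eqP; exact: is_reflection_signed. Qed.

Let W_refl x y : signed x -> signed y -> W (T x y).
Proof. exact: group_C_reflection. Qed.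

(** [T x y *m w] agrees with [w] at [x], so that the swap of [x] and [w x] is
    below it. *)
Let V_next x y : signed x -> signed y -> x <> y -> orb w x y ->
    w *m x <> x -> w *m x <> - x -> w *m x <> y -> w *m x <> - y ->
  V x y = V x (w *m x).
Proof.
move=> sx sy xy oxy w1 w2 w3 w4; have sx' := sw sx.
have uW : W (T x y *m w) by apply: group_CM => //; exact: W_refl.
apply: Lhead_compat; [exact: refl_ne|exact/refl_ne/nesym|].
rewrite -(orb_rho wW _ oxy); last exact/eqP.
rewrite orb_rho //; first by apply/eqP/nesym.
exists 1%N; rewrite /= -mulmxA; exact: signed_reflection_act.
Qed.

(** [w *m T x y] agrees with [w] at [z], so that the swap of [z] and [x] is
    below it. *)
Let V_prev z x y : signed z -> signed x -> signed y -> x <> y -> orb w x y ->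
    w *m z = x -> z <> x -> z <> - x -> z <> y -> z <> - y ->
  V z x = V x y.
Proof.
move=> sz sx sy xy oxy zE z1 z2 z3 z4.
have uW : W (w *m T x y) by apply: group_CM => //; exact: W_refl.
have tO := reflection_ortho_mat (x - y).
apply: Lhead_compat; [exact: refl_ne|exact: refl_ne|].
rewrite (rhoC _ tO) -mulmxA -(orb_rho wW _ oxy); last exact/eqP.
rewrite [rho (T x y *m w)](rhoC _ tO) orb_rho //; first exact/eqP.
exists 1%N; rewrite /= -mulmxA signed_reflection_act //.
Qed.

(** Here [w *m T x y] maps [y] to [- y]. *)
Let V_sign x y : signed x -> signed y -> x <> y -> orb w x y ->
  w *m x = - y -> V y (- y) = V x y.
Proof.
move=> sx sy xy oxy xE; have sNy := signedN sy.
have uW : W (w *m T x y) by apply: group_CM => //; exact: W_refl.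
have tO := reflection_ortho_mat (x - y).
apply: Lhead_compat; [exact/refl_ne/eqP/signed_neqN|exact: refl_ne|].
rewrite (rhoC _ tO) -mulmxA -(orb_rho wW _ oxy); last exact/eqP.
rewrite [rho (T x y *m w)](rhoC _ tO) orb_rho ?signed_neqN //.
exists 1%N; rewrite /= -mulmxA reflectionBC signed_reflection_swap //.
Qed.

(** The swaps of consecutive pairs [x, w x] and [w x, w^2 x] are compatible
    or equal, except for [w^2 x = - x]; then both are compatible with the sign
    change of [w x]. *)
Let V_step x : signed x -> w *m x <> x ->
  V x (w *m x) = V (w *m x) (w *m (w *m x)).
Proof.
move=> sx w1; set y := w *m x.
have sy : signed y := sw sx; have sz := sw sy; have sNy := signedN sy.
have [E|z1] := pselect (w *m y = x); first by rewrite E VC.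
have z3 : w *m y <> y by move/inj.
have yNx : y <> - x.
  by move=> E; apply: z1; rewrite E mulmxN -/y E opprK.
have z4 : w *m y <> - y.
  by rewrite -mulmxN => /inj.
have [E|z2] := pselect (w *m y = - x); last first.
  rewrite VC; apply: V_next => //; first exact: orb_sym (orb1 _ _).
have yNy : orb w y (- y).
  by exists 2%N; rewrite /= E mulmxN.
have y_ne : y <> - y by exact/eqP/signed_neqN.
have xNy : x <> - y by move=> E2; apply: yNx; rewrite E2 opprK.
have yx : y <> x by exact: w1.
have -> : V x y = V y (- y).
  apply: (V_prev sx sy sNy y_ne yNy (erefl _) (nesym yx) xNy xNy).
  by rewrite opprK; exact: nesym.
apply: (V_next sy sNy y_ne yNy z3 z4 z4).
by rewrite opprK.
Qed.

Let wx_ne x m : w *m x <> x ->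
  w *m iter m (mulmx w) x <> iter m (mulmx w) x.
Proof. by move=> x1; elim: m => //= m IHm /inj. Qed.

Let V_adj x y : signed x -> w *m x <> x -> orb w x y ->
  V x (w *m x) = V y (w *m y).
Proof.
move=> sx x1 [m <-]; elim: m => [|m ->]; first exact: erefl.
exact: (V_step (iter_signed m wW sx) (wx_ne x1)).
Qed.

Let moved x y : signed x -> x <> y -> orb w x y -> w *m x <> x.
Proof.
move=> sx xy [m mE] E; apply: xy; rewrite -mE.
by elim: m {mE} => //= m <-; rewrite E.
Qed.

Let V_orb x y : signed x -> signed y -> x <> y -> orb w x y ->
  V x y = V x (w *m x).
Proof.
move=> sx sy xy oxy; have x1 := moved sx xy oxy.
have [->//|x3] := pselect (w *m x = y).
have [E|x2] := pselect (w *m x = - x).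
  case: oxy => m mE; have : iter m (mulmx w) x = x \/ iter m (mulmx w) x = - x.
    elim: m {mE} => [|m [|] /= ->]; rewrite ?mulmxN ?E ?opprK; by [left|right].
  by rewrite mE E => -[yx|->]; [case: xy; exact: esym|exact: erefl].
have [E|x4] := pselect (w *m x = - y); last exact: V_next.
have sNy := signedN sy.
have w1 : w *m (- y) <> - y by rewrite -E; exact: (@wx_ne x 1 x1).
have w2 : w *m (- y) <> y.
  by rewrite mulmxN => /(congr1 -%R); rewrite opprK -E => /inj yx; case: xy.
have NyNy : - y <> y by exact/nesym/eqP/signed_neqN.
have oNy : orb w (- y) y.
  by rewrite -E; exact: orb_trans (orb_sym wW sx (orb1 w x)) oxy.
rewrite -(V_sign sx sy xy oxy E) (V_adj sx x1 (orb1 w x)) E VC.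
by apply: (V_next sNy sy NyNy oNy w1 _ w2 w1); rewrite opprK.
Qed.

(** In different orbits, [T x (w x) *m w] agrees with [w] at [y]. *)
Let V_far x y : signed x -> signed y -> ~ orb w x y -> ~ orb w x (- y) ->
  w *m x <> x -> w *m y <> y -> V x (w *m x) = V y (w *m y).
Proof.
move=> sx sy nxy nxNy x1 y1; have sx' := sw sx; have sy' := sw sy.
have uW : W (T x (w *m x) *m w) by apply: group_CM => //; exact: W_refl.
apply: Lhead_compat; [exact/refl_ne/nesym|exact/refl_ne/nesym|].
rewrite -(orb_rho wW _ (orb1 w x)); last exact/eqP/nesym.
rewrite orb_rho //; first exact/eqP/nesym.
exists 1%N; rewrite /= -mulmxA; apply: signed_reflection_act => //.
have back z : orb w x (w *m z) -> signed z -> orb w x z.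
  by move=> xz sz; apply: orb_trans xz (orb_sym wW sz (orb1 w z)).
have sNy := signedN sy; split=> E.
- by apply: nxy; apply: back => //; rewrite E; exact: orb_refl.
- by apply: nxNy; apply: back => //; rewrite mulmxN E opprK; exact: orb_refl.
- by apply: nxy; apply: back => //; rewrite E; exact: orb1.
- by apply: nxNy; apply: back => //; rewrite mulmxN E opprK; exact: orb1.
Qed.

Lemma Lhead_const t t' : refl t -> refl t' -> (rho (t *m w)).+1 = rho w ->
  (rho (t' *m w)).+1 = rho w -> Lhead w t = Lhead w t'.
Proof.
move=> /reflection_signedP[x [y [sx sy xy ->]]].
move=> /reflection_signedP[x' [y' [sx' sy' x'y' ->]]] tw t'w.
have oxy := rho_orb wW wg sx sy xy tw.
have ox'y' := rho_orb wW wg sx' sy' x'y' t'w.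
move/eqP in xy; move/eqP in x'y'.
have x1 := moved sx xy oxy; have x'1 := moved sx' x'y' ox'y'.
apply: etrans (V_orb sx sy xy oxy) _.
apply: etrans (esym (V_orb sx' sy' x'y' ox'y')).
have [oxx'|nxx'] := pselect (orb w x x'); first exact: (V_adj sx x1 oxx').
have [oxNx'|nxNx'] := pselect (orb w x (- x')); last first.
  exact: (V_far sx sx' nxx' nxNx' x1 x'1).
by rewrite (V_adj sx x1 oxNx') mulmxN VN.
Qed.

End Step.

(** In terms of words: Hurwitz moves connect any two reduced factorisations of
    [w], and [L_pair] says that [L] is invariant under them. By induction on
    the rank only the first letters matter, and [Lhead_const] deals with
    these. *)
Theorem Lword_reduced w : W w -> wle w g -> forall r, refls r ->
  mulmxs r = w -> size r = rho w -> Lword r = Lword (rword w).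
Proof.
move: {2}(rho w) (leqnn (rho w)) => k; elim: k w => [|k IHk] w wk wW wg r rR rE rs.
  have [_ _ ws] := rwordP wW; move: wk; rewrite leqn0 => /eqP wk.
  by rewrite wk in rs ws; rewrite (size0nil rs) (size0nil ws).
have IH u : W u -> wle u g -> (rho u < rho w)%N -> forall r, refls r ->
    mulmxs r = u -> size r = rho u -> Lword r = Lword (rword u).
  by move=> uW ug lt_uw; apply: IHk => //; exact: leq_trans lt_uw wk.
have [] := rwordP wW; case: r rR rE rs => [|t r] rR rE rs.
  by move=> _ _; rewrite -rs => /size0nil ->.
case: (rword w) => [|t' r'] r'R r'E r's; first by rewrite -r's in rs.
rewrite (Lhead_word wW wg IH rR rE rs) (Lhead_word wW wg IH r'R r'E r's).
have down u s : refls (u :: s) -> mulmxs (u :: s) = w -> size (u :: s) = rho w ->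
    refl u /\ (rho (u *m w)).+1 = rho w.
  move=> /refls_cons[uR sR] /= usE us; split=> //.
  have sE : mulmxs s = u *m w by rewrite -usE mulmxA is_reflectionK // mul1mx.
  have := rho_mulmxs sR; rewrite sE.
  case/reflection_signedP: (uR) => x [y [_ _ _ uE]].
  have := rho_reflection_ge (x - y) w; rewrite -uE; move: us.
  by move: (rho w) (rho (u *m w)) (size s); lia.
have [tR tw] := down _ _ rR rE rs; have [t'R t'w] := down _ _ r'R r'E r's.
exact: Lhead_const.
Qed.

End Hurwitz.

(** * Coxeter elements permute the signed basis vectors cyclically *)
Section CoxeterCycle.
Local Open Scope ring_scope.
Variables (R : realType) (n m : nat) (A : 'M[R]_(n, m)).
Implicit Types (x y z v : 'cV[R]_n) (c : 'cV[R]_m).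
Local Notation W := (@group_C R n).
Hypothesis n_gt0 : (0 < n)%N.
Hypothesis A_simple : simple_system W A.

Let comb_inj c (d : 'cV[R]_m) : A *m c = A *m d -> c = d.
Proof.
case: A_simple => A_free _ _ E; apply: trmx_inj.
by apply: (row_free_inj A_free); rewrite -!trmx_mul E.
Qed.

Let dl (i : 'I_m) : 'cV[R]_m := delta_mx i 0.

Let colA i : col i A = A *m dl i. Proof. exact: colE. Qed.

Let dlE i j : dl i j 0 = (j == i)%:R. Proof. by rewrite mxE eqxx andbT. Qed.

Definition pos_root v := exists2 c, v = A *m c & forall i, 0 <= c i 0.

Let root_or v : is_root W v -> pos_root v \/ pos_root (- v).
Proof.
case: A_simple => _ _ H /H[c -> [cp|cn]]; [left|right]; first by exists c.
by exists (- c) => [|i]; rewrite ?mulmxN // mxE oppr_ge0.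
Qed.

Let unitv_root k : is_root W (unitv R k).
Proof.
have sk := signed_unitv R k.
have E : unitv R k = (1 / 2) *: (unitv R k - - unitv R k).
  by rewrite opprK -mulr2n -scaler_nat scalerA mul1r mulVf ?scale1r // pnatr_eq0.
split; first exact: signed_neq0.
rewrite E reflectionZ; first by apply: group_C_reflection => //; exact: signedN.
by rewrite mul1r invr_neq0 // pnatr_eq0.
Qed.

Let pos_basis_ex k : exists v,
  (v = unitv R k \/ v = - unitv R k) /\ pos_root v.
Proof.
by case: (root_or (unitv_root k)) => H;
  [exists (unitv R k)|exists (- unitv R k)]; split=> //; [left|right].
Qed.

(** Of each pair of opposite basis vectors, the one that is a positive root. *)
Let f : 'I_n -> 'cV[R]_n := projT1 (choice pos_basis_ex).

Let fP k : (f k = unitv R k \/ f k = - unitv R k) /\ pos_root (f k).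
Proof. by rewrite /f; case: choice. Qed.

Let f_signed k : signed (f k).
Proof. by case: (fP k) => -[->|->] _; exists k; [left|right]. Qed.

Let f_dot k l : dot (f k) (f l) = (k == l)%:R.
Proof.
have [->|kl] := eqVneq k l; first by rewrite signed_dot1.
by case: (fP k) (fP l) => -[->|->] _ [[->|->] _];
  rewrite ?dotNl ?dotNr dot_unitv unitvE (negPf kl) ?oppr0.
Qed.

Let f_signedP x : signed x -> exists k, x = f k \/ x = - f k.
Proof.
case=> k xk; exists k; case: (fP k) => -[->|->] _; case: xk => ->.
- by left.
- by right.
- by right; rewrite opprK.
by left.
Qed.

Let f_sum_dot (P : pred 'I_n) k : dot (f k) (\sum_(l | P l) f l) = (P k)%:R.
Proof.
rewrite dotC dot_suml; have [Pk|nPk] := boolP (P k).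
  rewrite (bigD1 k) //= signed_dot1 // big1 ?addr0 // => l /andP[_ lk].
  by rewrite f_dot (negPf lk).
rewrite big1 // => l Pl; rewrite f_dot; case: eqP => // lk.
by rewrite -lk Pl in nPk.
Qed.

(** By [root_signed] the only other shape would be [f k + f l]. That is a sum
    of two positive roots, so that it can be a multiple of a simple root only if
    both of them are. *)
Let col_shape i : exists kl : 'I_n * 'I_n, exists2 c, c != 0 &
  col i A = c *: (if kl.1 == kl.2 then f kl.1 else f kl.1 - f kl.2).
Proof.
case: A_simple => _ /(_ i)/root_signed[x [y [sx sy xy [c c0 E]]]] _.
suff [k [l [e e0 ->]]] : exists k l, exists2 e, e != 0 &
    col i A = e *: (if k == l then f k else f k - f l).
  by exists (k, l), e.
have [k xk] := f_signedP sx; have [l yl] := f_signedP sy.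
have [kl|kl] := eqVneq k l; last first.
  have bad e : col i A = e *: (f k + f l) -> False.
    have [ck fk ck0] := (fP k).2; have [cl fl cl0] := (fP l).2.
    rewrite colA {1}fk {1}fl -mulmxDr scalemxAr => /comb_inj ekl.
    have e_gt0 : 0 < e.
      have := congr1 (fun M : 'cV_m => M i 0) ekl; rewrite dlE eqxx !mxE => ei.
      rewrite ltNge; apply/negP => e0.
      have : (1 : R) <= 0; last by rewrite ler10.
      by rewrite [1]ei mulr_le0_ge0 // addr_ge0.
    have off j : j != i -> ck j 0 = 0 /\ cl j 0 = 0.
      move=> ji; have := congr1 (fun M : 'cV_m => M j 0) ekl.
      rewrite dlE (negPf ji) !mxE => /esym/eqP.
      rewrite mulf_eq0 gt_eqF //= paddr_eq0 // => /andP[/eqP -> /eqP ->] //.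
    have fkE : f k = ck i 0 *: col i A.
      rewrite fk colA scalemxAr; congr (A *m _); apply/matrixP => j j'.
      rewrite ord1 [RHS]mxE dlE; have [->|/off[-> _]] := eqVneq j i.
        by rewrite mulr1.
      by rewrite mulr0.
    have flE : f l = cl i 0 *: col i A.
      rewrite fl colA scalemxAr; congr (A *m _); apply/matrixP => j j'.
      rewrite ord1 [RHS]mxE dlE; have [->|/off[_ ->]] := eqVneq j i.
        by rewrite mulr1.
      by rewrite mulr0.
    have := f_dot k l; rewrite (negPf kl) => /eqP.
    rewrite {1}fkE {1}flE dotZl dotZr !mulf_eq0.
    have fk0 := signed_neq0 (f_signed k); have fl0 := signed_neq0 (f_signed l).
    case/or3P => /eqP z0.
    - by move: fk0; rewrite fkE z0 scale0r eqxx.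
    - by move: fl0; rewrite flE z0 scale0r eqxx.
    move/eqP: z0; rewrite dot_eq0 => /eqP z0.
    by move: fk0; rewrite fkE z0 scaler0 eqxx.
  exists k, l; rewrite (negPf kl); case: xk yl E => -> [->|->] E.
  - by exists c.
  - by case: (bad c); rewrite E opprK.
  - by case: (bad (- c)); rewrite E scaleNr -scalerN opprD.
  - by exists (- c); rewrite ?oppr_eq0 // E scaleNr -scalerN opprB opprK addrC.
have xNy : y = - x.
  case: xk yl xy => -> [->|->]; rewrite -kl ?opprK ?eqxx //.
have [e e0 xe] : exists2 e, e != 0 & x = e *: f k.
  case: xk => ->; first by exists 1; rewrite ?oner_eq0 ?scale1r.
  by exists (-1); rewrite ?oppr_eq0 ?oner_eq0 // scaleN1r.
exists k, k, (c * 2 * e); first by rewrite !mulf_neq0 // pnatr_eq0.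
by rewrite eqxx E xNy opprK -mulr2n -scaler_nat xe !scalerA.
Qed.

Let ends : 'I_m -> 'I_n * 'I_n := projT1 (choice col_shape).

Let endsP i : exists2 c, c != 0 & col i A =
  c *: (if (ends i).1 == (ends i).2 then f (ends i).1
        else f (ends i).1 - f (ends i).2).
Proof. by rewrite /ends; case: choice. Qed.

Let short i := (ends i).1 == (ends i).2.

(** The simple roots span the space, as they span all the [f k]. *)
Let sep x : (forall i, dot (col i A) x = 0) -> x = 0.
Proof.
move=> H; have AH c : dot (A *m c) x = 0.
  rewrite /dot trmx_mul -mulmxA.
  have -> : A^T *m x = 0; last by rewrite mulmx0 mxE.
  apply/matrixP => i j; rewrite ord1 [RHS]mxE -(H i) dotE mxE.
  by apply: eq_bigr => k _; rewrite !mxE.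
apply/eqP; rewrite -dot_eq0; apply/eqP.
have xk k : dot (f k) x = 0 by have [c -> _] := (fP k).2.
have xk' k : x k 0 = 0.
  rewrite -dot_unitv; have := xk k; case: (fP k) => -[->|->] _ //.
  by rewrite dotNl => /eqP; rewrite oppr_eq0 => /eqP.
by rewrite dotE big1 // => k _; rewrite xk' mul0r.
Qed.

(** Otherwise the sum of all the [f k] would be orthogonal to all the simple
    roots. *)
Let short_ex : exists i, short i.
Proof.
apply: contrapT => /forallNP no.
have /sep E : forall i, dot (col i A) (\sum_(l | xpredT l) f l) = 0.
  move=> i; have [c _ ->] := endsP i.
  by have /negP/negPf := no i; rewrite /short => ->;
    rewrite dotZl dotBl !f_sum_dot subrr mulr0.
have := f_sum_dot xpredT (Ordinal n_gt0); rewrite E dot0r => /esym/eqP.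
by rewrite oner_eq0.
Qed.

(** Multiples [f k] and [f l] of two simple roots would give a root [f k - f l]
    with coefficients of both signs. *)
Let short_uniq i j : short i -> short j -> i = j.
Proof.
move=> si sj; apply/eqP; apply: contraT => ij.
have [c c0] := endsP i; rewrite -/(short i) si => Ei.
have [d d0] := endsP j; rewrite -/(short j) sj => Ej.
have inv k e v : e != 0 -> col k A = e *: v -> v = A *m (e^-1 *: dl k).
  by move=> e0 E; rewrite -scalemxAr -colA E scalerA mulVf ?scale1r.
have pos k l e : e != 0 -> col k A = e *: f l -> 0 < e.
  move=> e0 E; have [cl fl cl0] := (fP l).2.
  have := inv _ _ _ e0 E; rewrite fl => /comb_inj/(congr1 (fun M : 'cV_m => M k 0)).
  rewrite mxE dlE eqxx mulr1 => ek; have := cl0 k; rewrite ek invr_ge0.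
  by rewrite le_eqVlt eq_sym (negPf e0).
have cp := pos _ _ _ c0 Ei; have dp := pos _ _ _ d0 Ej.
have fE : f (ends i).1 - f (ends j).1 = A *m (c^-1 *: dl i - d^-1 *: dl j).
  by rewrite mulmxBr -(inv _ _ _ c0 Ei) -(inv _ _ _ d0 Ej).
have [ai aj] : (c^-1 *: dl i - d^-1 *: dl j) i 0 = c^-1 /\
    (c^-1 *: dl i - d^-1 *: dl j) j 0 = - d^-1.
  by rewrite !mxE !eqxx (negPf ij) eq_sym (negPf ij) /= !mulr0 !mulr1 subr0 sub0r.
have ip : 0 < c^-1 by rewrite invr_gt0.
have dip : 0 < d^-1 by rewrite invr_gt0.
have [E|kl] := eqVneq (f (ends i).1) (f (ends j).1).
  move: fE; rewrite E subrr -{1}(mulmx0 _ A) => /comb_inj E0.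
  by move: ai; rewrite -E0 mxE => ai; move: ip; rewrite -ai ltxx.
have r : is_root W (f (ends i).1 - f (ends j).1).
  by split; [rewrite subr_eq0|apply: group_C_reflection].
case: A_simple => _ _ /(_ _ r)[c' E] [] s'.
  have := s' j; move: E; rewrite fE => /comb_inj <-.
  by rewrite aj oppr_ge0 leNgt dip.
have := s' i; move: E; rewrite fE => /comb_inj <-.
by rewrite ai leNgt ip.
Qed.

Let M (s : seq 'I_m) := mulmxs [seq reflection (col i A) | i <- s].

(** The product moves [x] by a combination of the roots, and only one of the
    reflections contributes to each coefficient. By independence a fixed [x]
    has all these contributions 0, which means, starting from the reflection
    applied first, that each of them fixes [x]. *)
Let M_fix s x : uniq s -> M s *m x = x ->
  forall i, i \in s -> dot (col i A) x = 0.
Proof.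
move=> us sx; suff H : exists c, [/\ M s *m x = x + A *m c,
    forall i, i \notin s -> c i 0 = 0 &
    c = 0 -> forall i, i \in s -> dot (col i A) x = 0].
  have [c [E _ H0]] := H; apply: H0; apply: comb_inj; rewrite mulmx0.
  by apply: (addrI x); rewrite addr0 -E sx.
elim: s us {sx} => [|j s IH] /= => [_|/andP[js /IH[c [E c0 H0]]]].
  by exists 0; rewrite /M /= mul1mx mulmx0 addr0; split=> // i _; rewrite mxE.
pose e := 2 * dot (col j A) (M s *m x) / dot (col j A) (col j A).
exists (c - e *: dl j); split.
- rewrite /M /= -mulmxA reflectionE -/(M s) -/e E mulmxBr -scalemxAr -colA.
  by rewrite addrA.
- move=> i; rewrite inE negb_or => /andP[ij is_]; rewrite !mxE c0 //.
  by rewrite eq_sym in ij; rewrite eq_sym (negPf ij) mulr0 subr0.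
move=> Z; have e0 : e = 0.
  have := congr1 (fun M : 'cV_m => M j 0) Z; rewrite !mxE c0 // !eqxx mulr1 sub0r.
  by move/eqP; rewrite oppr_eq0 => /eqP.
have cz : c = 0 by move: Z; rewrite e0 scale0r subr0.
move=> i; rewrite inE => /predU1P[->|is_]; last exact: H0.
have: e == 0 by rewrite e0.
rewrite /e E cz mulmx0 addr0 !mulf_eq0 pnatr_eq0 invr_eq0 /=.
case: A_simple => _ /(_ j)[j0 _] _.
by rewrite dot_eq0 (negPf j0) orbF => /eqP.
Qed.

(** The permutation of the coordinates that is left when signs are forgotten. *)
Let sigma (s : seq 'I_m) : 'S_n :=
  foldr (fun i p => (p * tperm (ends i).1 (ends i).2)%g) 1%g s.

Let refl_long i k : ~~ short i ->
  reflection (col i A) *m f k = f (tperm (ends i).1 (ends i).2 k).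
Proof.
move=> si; have [c c0 ->] := endsP i; rewrite -/(short i) (negPf si).
rewrite reflectionZ //; case: tpermP => [->|->|k1 k2].
- exact: signed_reflection_swap.
- by rewrite reflectionBC; exact: signed_reflection_swap.
apply: reflection_fix; rewrite dotBl !f_dot ![_ == k]eq_sym.
by move/eqP/negPf: k1 => ->; move/eqP/negPf: k2 => ->; rewrite subrr.
Qed.

Let refl_short i k : short i ->
  reflection (col i A) *m f k = f k \/ reflection (col i A) *m f k = - f k.
Proof.
move=> si; have [c c0 ->] := endsP i; rewrite -/(short i) si reflectionZ //.
have [->|k1] := eqVneq k (ends i).1; [right|left].
  exact/reflection_self/signed_neq0.
by apply: reflection_fix; rewrite f_dot eq_sym (negPf k1).
Qed.

Let M_act s k : M s *m f k = f (sigma s k) \/ M s *m f k = - f (sigma s k).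
Proof.
elim: s => [|i s IH] /=; first by rewrite /M /= mul1mx perm1; left.
rewrite /M /= -mulmxA permM -/(M s).
have H l : reflection (col i A) *m f l = f (tperm (ends i).1 (ends i).2 l) \/
    reflection (col i A) *m f l = - f (tperm (ends i).1 (ends i).2 l).
  have [si|si] := boolP (short i); last by left; exact: refl_long.
  by rewrite (eqP si) tperm1 perm1; exact: refl_short.
by case: IH => ->; case: (H (sigma s k)); rewrite ?mulmxN => ->; rewrite ?opprK;
  [left|right|right|left].
Qed.

Let M_act_long s k : M [seq i <- s | ~~ short i] *m f k = f (sigma s k).
Proof.
elim: s => [|i s IH] /=; first by rewrite /M /= mul1mx perm1.
rewrite permM; case: ifP => si; first by rewrite /M /= -mulmxA -/(M _) IH refl_long.
by move/negbFE: si => /eqP ->; rewrite IH tperm1 perm1.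
Qed.

Let s0 := enum 'I_m.

(** The sum [y] of the [f l] over the orbit of [k] is fixed by the product of
    the reflections in the roots [f k - f l], so by [M_fix] it is orthogonal to
    these roots. Subtracting a multiple of the sum of all the [f l] one gets
    orthogonality to the one remaining simple root, hence to all. So [y] is
    that multiple. *)
Let sigma_transitive k : porbit (sigma s0) k = [set: 'I_n].
Proof.
set O := porbit _ k; have [i0 si0] := short_ex.
pose y := \sum_(l | l \in O) f l.
have Uy : M [seq i <- s0 | ~~ short i] *m y = y.
  rewrite /y mulmx_sumr (eq_bigr (fun l => f (sigma s0 l))) => [|l _]; last first.
    exact: M_act_long.
  rewrite [RHS](reindex_inj (@perm_inj _ (sigma s0))) /=; apply: eq_bigl => l.
  have := porbit_perm (sigma s0) 1 l; rewrite expg1 => pl.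
  by rewrite /O -!eq_porbit_mem pl.
have us : uniq [seq i <- s0 | ~~ short i] by rewrite filter_uniq // enum_uniq.
have y_long i : ~~ short i -> dot (col i A) y = 0.
  by move=> si; apply: (M_fix us Uy); rewrite mem_filter si mem_enum.
pose y' := y - ((ends i0).1 \in O)%:R *: \sum_(l | xpredT l) f l.
have /sep y'0 : forall i, dot (col i A) y' = 0.
  move=> i; rewrite dotBr dotZr; have [si|si] := boolP (short i).
    have [c _ ->] := endsP i; rewrite -/(short i) si dotZl dotZl.
    by rewrite !f_sum_dot (short_uniq si si0) mulrCA mulr1 subrr.
  rewrite y_long //; have [c _ ->] := endsP i; rewrite -/(short i) (negPf si).
  by rewrite dotZl dotBl !f_sum_dot subrr !mulr0 subrr.
have y'E l : (l \in O)%:R = ((ends i0).1 \in O)%:R :> R.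
  apply/eqP; rewrite -subr_eq0; have := dot0r (f l); rewrite -y'0 dotBr dotZr.
  by rewrite !f_sum_dot mulr1 => ->.
have iO : (ends i0).1 \in O.
  have := y'E k; rewrite porbit_id; case: (_ \in O) => // /eqP.
  by rewrite oner_eq0.
apply/setP => l; rewrite inE; have := y'E l; rewrite iO; case: (_ \in O) => //.
by move/esym/eqP; rewrite oner_eq0.
Qed.

(** By [sigma_transitive] the [n]-th power of [g] is 1 or -1 on [f k0]. In the
    first case the sum of the orbit would be a nonzero fixed vector of [g],
    against [M_fix] and [sep]. *)
Lemma simple_product_cycle (g := \big[mulmx/1%:M]_(i < m) reflection (col i A)) :
  exists2 x, signed x & [/\ iter n (mulmx g) x = - x,
    forall d, (0 < d < n)%N -> dot x (iter d (mulmx g) x) = 0 &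
    forall y, signed y -> exists p, y = iter p (mulmx g) x].
Proof.
have gE : g = M s0 by rewrite /g big_mulmxs.
pose k0 := Ordinal n_gt0; pose s := sigma s0.
have orbit_size : #|porbit s k0| = n.
  by rewrite /s sigma_transitive cardsT card_ord.
have act d : iter d (mulmx g) (f k0) = f (iter d s k0) \/
    iter d (mulmx g) (f k0) = - f (iter d s k0).
  rewrite gE; elim: d => [|d IH] /=; first by left.
  by case: IH => ->; case: (M_act s0 (iter d s k0)); rewrite ?mulmxN => ->;
    rewrite ?opprK; [left|right|right|left].
have iter_n : iter n s k0 = k0 by have := iter_porbit s k0; rewrite orbit_size.
have iter_ne d : (0 < d < n)%N -> iter d s k0 != k0.
  move=> /andP[d0 dn]; have := uniq_traject_porbit s k0; rewrite orbit_size.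
  move=> u; have := nth_uniq k0 _ _ u; rewrite size_traject => /(_ d 0%N dn n_gt0).
  by rewrite !nth_traject // => ->; rewrite gt_eqF.
have orth d : (0 < d < n)%N -> dot (f k0) (iter d (mulmx g) (f k0)) = 0.
  move=> /iter_ne dn; case: (act d) => ->; rewrite ?dotNr f_dot eq_sym (negPf dn) //.
  by rewrite oppr0.
have g_fix x : g *m x = x -> x = 0.
  move=> gx; apply: sep => i; apply: (@M_fix s0); rewrite ?enum_uniq ?mem_enum //.
  by rewrite -gE.
have gn : iter n (mulmx g) (f k0) = - f k0.
  case: (act n); rewrite iter_n // => gn.
  pose z := \sum_(0 <= d < n) iter d (mulmx g) (f k0).
  have /g_fix z0 : g *m z = z by exact: iter_sum_fix.
  have := dot0r (f k0); rewrite -z0 dotC /z dot_suml big_ltn //= signed_dot1 //.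
  rewrite big_nat big1 ?addr0 => [/eqP|d dn]; first by rewrite oner_eq0.
  by rewrite dotC orth.
exists (f k0) => //; split=> // y /f_signedP[l yl].
have : l \in porbit s k0 by rewrite /s sigma_transitive inE.
rewrite porbit_traject => /trajectP[d _ lE].
have fl : f l = iter d (mulmx g) (f k0) \/ f l = iter (d + n) (mulmx g) (f k0).
  by rewrite iterD gn iter_mulmxN lE; case: (act d) => ->; rewrite ?opprK;
    [left|right].
case: yl => ->; first by case: fl => ->; [exists d|exists (d + n)%N].
case: fl => ->; first by exists (d + n)%N; rewrite iterD gn iter_mulmxN.
by exists d; rewrite iterD gn iter_mulmxN opprK.
Qed.

End CoxeterCycle.

(** * Relations of the poset group *)
Section PosetGroup.
Local Open Scope ring_scope.
Variables (R : realType) (n : nat) (g : 'M[R]_n).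
Local Notation W := (@group_C R n).
Local Notation refl := (is_reflection W).
Local Notation Gam := (poset_group W g).
Implicit Types (u w t : 'M[R]_n).
Hypothesis gW : W g.

Lemma poset_intervalE w : poset_interval W g w <->
  [/\ W w, wle w g & w <> 1%:M].
Proof.
by split=> -[wW wg w1]; split=> //; apply/(refl_leE wW gW).
Qed.

(** With the value 1 for the identity matrix the product rule [eltM] needs no
    exception for trivial factors. *)
Definition elt w : Gam :=
  if pselect (poset_interval W g w) is left p
  then gen (@poset_rels R n W g) (exist _ w (mem_set p)) else 1%g.

Lemma elt_val (x : poset_interval W g) :
  elt (val x) = gen (@poset_rels R n W g) x.
Proof.
rewrite /elt; case: pselect => [p|]; last by case; exact: (set_mem (valP x)).
by congr gen; exact: val_inj.
Qed.

Lemma elt1 : elt 1%:M = 1%g.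
Proof. by rewrite /elt; case: pselect => // -[]. Qed.

(** The factor [w] of [g = u w v] may be moved to the front by conjugating [u],
    which does not change the rank of [u]. *)
Lemma wle_factors u w : W u -> W w -> wle (u *m w) g ->
  rho (u *m w) = (rho u + rho w)%N -> wle u g /\ wle w g.
Proof.
move=> uW wW; have uO := group_C_ortho_mat uW; have wO := group_C_ortho_mat wW.
rewrite /wle => uwg uw; set v := (u *m w)^T *m g in uwg.
have gE : g = u *m (w *m v).
  by rewrite /v trmx_mul -mulmxA ortho_matKV // ortho_matKV.
have H1 := rho_mul w v; have H2 := rho_mul u (w *m v); rewrite -gE in H2.
have uE : u^T *m g = w *m v by rewrite {1}gE ortho_matK.
have wE : w^T *m g = (w^T *m u *m w^T^T) *m v.
  by rewrite trmxK {1}gE !mulmxA.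
have H3 := rho_mul (w^T *m u *m w^T^T) v.
rewrite -wE rho_conj in H3; last exact: ortho_mat_tr.
have H4 := rho_mul w (w^T *m g); rewrite ortho_matKV // in H4.
rewrite uE; move: uwg uw H1 H2 H3 H4.
move: (rho g) (rho u) (rho w) (rho v) (rho (u *m w)) (rho (w *m v))
  (rho (w^T *m g)) => *; lia.
Qed.

Lemma eltM u w : W u -> W w -> wle (u *m w) g ->
  rho (u *m w) = (rho u + rho w)%N -> (elt u * elt w)%g = elt (u *m w).
Proof.
move=> uW wW uwg uw; have [ug wg] := wle_factors uW wW uwg uw.
have uO := group_C_ortho_mat uW.
have [u1|u1] := pselect (u = 1%:M); first by rewrite u1 elt1 mul1g mul1mx.
have [w1|w1] := pselect (w = 1%:M); first by rewrite w1 elt1 mulg1 mulmx1.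
have uwW : W (u *m w) by exact: group_CM.
have uw1 : u *m w <> 1%:M.
  by move=> E; apply: u1; apply: rho_eq0; move: uw; rewrite E rho1; lia.
have Iu : poset_interval W g u by apply/poset_intervalE.
have Iw : poset_interval W g w by apply/poset_intervalE.
have Iuw : poset_interval W g (u *m w) by apply/poset_intervalE.
pose x : poset_interval W g := exist _ u (mem_set Iu).
pose y : poset_interval W g := exist _ w (mem_set Iw).
pose z : poset_interval W g := exist _ (u *m w) (mem_set Iuw).
rewrite -[u]/(val x) -[w]/(val y) -[val x *m val y]/(val z) !elt_val.
rewrite /gen -pres_classM; apply/pres_classP/pres_rel; apply: PosetRel => /=.
  by apply/(refl_leE uW uwW); rewrite ortho_matK.
by rewrite ortho_mat_inv // ortho_matK.
Qed.

Lemma elt_pair t t' : refl t -> refl t' ->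
  (rho (t' *m (t *m g))).+2 = rho g ->
  (elt t * elt t')%g = elt (t *m t').
Proof.
move=> tR t'R H; have tW := group_C_is_reflection tR.
have t'W := group_C_is_reflection t'R.
have H1 := rho_mul t t'; have H2 := rho_mul (t *m t') (t' *m (t *m g)).
have E : (t *m t') *m (t' *m (t *m g)) = g.
  by rewrite -!mulmxA (mulmxA t' t') is_reflectionK // mul1mx mulmxA
    is_reflectionK // mul1mx.
rewrite E in H2; rewrite (is_reflection_rho tR) (is_reflection_rho t'R) in H1.
have tt2 : rho (t *m t') = 2%N.
  by move: H H1 H2; move: (rho g) (rho (_ *m _)) (rho (_ *m _)) => *; lia.
apply: eltM => //.
  by rewrite /wle trmx_mul (is_reflection_tr tR) (is_reflection_tr t'R) -mulmxA tt2.
by rewrite tt2 (is_reflection_rho tR) (is_reflection_rho t'R).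
Qed.

Lemma pair_next t t' : refl t' ->
  (rho (t' *m (t *m g))).+2 = rho g ->
  (rho ((t' *m t *m t') *m (t' *m g))).+2 = rho g.
Proof.
by move=> t'R; rewrite -!mulmxA (mulmxA t' t') is_reflectionK // mul1mx.
Qed.

(** Both sides are the generator of [t *m t']. *)
Lemma elt_braid t t' : refl t -> refl t' ->
  (rho (t' *m (t *m g))).+2 = rho g ->
  (elt t * elt t')%g = (elt t' * elt (t' *m t *m t'))%g.
Proof.
move=> tR t'R H; rewrite elt_pair // elt_pair //.
- by congr elt; rewrite !mulmxA is_reflectionK // mul1mx.
- rewrite -{2}(is_reflection_tr t'R).
  by apply: is_reflection_conj => //; exact: group_C_is_reflection.
exact: pair_next.
Qed.

Lemma elt_word r : refls r -> wle (mulmxs r) g -> size r = rho (mulmxs r) ->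
  elt (mulmxs r) = (\prod_(t <- r) elt t)%g.
Proof.
elim: r => [|t r IH]; first by rewrite big_nil /= elt1.
move=> /refls_cons[tR rR] /= wg rs; have tW := group_C_is_reflection tR.
have rW := refls_group_C rR.
have le_r := rho_mulmxs rR; have le_t := rho_mul t (mulmxs r).
rewrite (is_reflection_rho tR) in le_t.
have E : rho (t *m mulmxs r) = (rho t + rho (mulmxs r))%N.
  by rewrite (is_reflection_rho tR); lia.
have [_ rg] := wle_factors tW rW wg E.
rewrite big_cons -IH //; first by rewrite eltM.
by rewrite (is_reflection_rho tR) in E; lia.
Qed.

(** Both sides, multiplied out, split [g] through [g *m t]:
    [g = (g t) t = (g t g^T) (g t)]. *)
Lemma elt_conj t : refl t -> (rho (t *m g)).+1 = rho g ->
  (elt g * elt t)%g = (elt (g *m t *m g^T) * elt g)%g.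
Proof.
move=> tR H; have tW := group_C_is_reflection tR.
have gO := group_C_ortho_mat gW; have gT := group_C_tr gW.
have gtW : W (g *m t) by exact: group_CM.
have t'R : refl (g *m t *m g^T) by exact: is_reflection_conj.
have t'W := group_C_is_reflection t'R.
have gg : wle g g by rewrite /wle gO rho1 addn0.
have rgt : (rho (g *m t)).+1 = rho g by rewrite rhoC.
have E1 : g = (g *m t) *m t by rewrite -mulmxA is_reflectionK // mulmx1.
have E2 : g = (g *m t *m g^T) *m (g *m t).
  by rewrite -mulmxA ortho_matK // -mulmxA is_reflectionK // mulmx1.
have H1 : (elt (g *m t) * elt t)%g = elt g.
  have := eltM gtW tW; rewrite -E1; apply=> //.
  by rewrite (is_reflection_rho tR) addn1.
have H2 : (elt (g *m t *m g^T) * elt (g *m t))%g = elt g.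
  have := eltM t'W gtW; rewrite -E2; apply=> //.
  by rewrite (is_reflection_rho t'R) add1n.
by rewrite -{1}H2 -H1 mulgA.
Qed.

End PosetGroup.

(** * The relations of the Artin group *)
Section Braids.
Local Open Scope group_scope.
Variable G : groupType.
Implicit Types a b c d : G.

(** The Artin groups of types A2 and B2 are also presented by the equality of
    the products of consecutive elements in a cyclic sequence of three,
    respectively four, generators. *)
Lemma braid3_of_triangle a b c : a * b = b * c -> b * c = c * a ->
  a * b * a = b * a * b.
Proof. by move=> ab bc; rewrite -[RHS]mulgA ab bc mulgA -bc -ab. Qed.

Lemma braid4_of_square a b c d : a * b = b * c -> b * c = c * d ->
  c * d = d * a -> a * b * a * b = b * a * b * a.
Proof.
move=> ab bc cd; rewrite -[LHS]mulgA -(mulgA b) ab bc {2}cd !mulgA.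
by rewrite -bc.
Qed.
End Braids.

Section ArtinGenerators.
Variable n : nat.

(** Generators indexed by all natural numbers spare the proofs of [p < n] in
    products over an interval. *)
Definition artin_gen p : artin_C n :=
  if insub p is Some i then gen (@artin_C_rels n) i else 1%g.

Local Notation x := artin_gen.

Lemma artin_genE (i : 'I_n) : x i = gen (@artin_C_rels n) i.
Proof. by rewrite /artin_gen valK. Qed.

Let x_rel (u v : word 'I_n) : artin_C_rels u v ->
  pres_class (@artin_C_rels n) u = pres_class (@artin_C_rels n) v.
Proof. by move=> uv; apply/pres_classP/pres_rel. Qed.

Lemma artin_braid4 : (1 < n)%N ->
  (x 0 * x 1 * x 0 * x 1 = x 1 * x 0 * x 1 * x 0)%g.
Proof.
move=> n_gt1; have n0 : (0 < n)%N by lia.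
have := x_rel (@ArtinBraid4 n (Ordinal n0) (Ordinal n_gt1) erefl erefl).
by rewrite !(pres_class_cons, pres_class1, mulg1, mulgA) -!artin_genE.
Qed.

Lemma artin_braid3 i : (0 < i)%N -> (i.+1 < n)%N ->
  (x i * x i.+1 * x i = x i.+1 * x i * x i.+1)%g.
Proof.
move=> i0 iN; have iN' : (i < n)%N by lia.
have := x_rel (@ArtinBraid3 n (Ordinal iN') (Ordinal iN) i0 erefl).
by rewrite !(pres_class_cons, pres_class1, mulg1, mulgA) -!artin_genE.
Qed.

Lemma artin_comm i j : (i.+2 <= j)%N -> (j < n)%N -> commute (x i) (x j).
Proof.
move=> ij jn; have iN : (i < n)%N by lia.
have ijC : (i.+2 <= j)%N || (j.+2 <= i)%N by rewrite ij.
have := x_rel (@ArtinComm n (Ordinal iN) (Ordinal jn) ijC).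
by rewrite !(pres_class_cons, pres_class1, mulg1, mulgA) -!artin_genE.
Qed.

End ArtinGenerators.

(** * The polygon of a Coxeter element *)
Section Chords.
Local Open Scope ring_scope.
Variables (R : realType) (n : nat) (g : 'M[R]_n) (b0 : 'cV[R]_n).
Local Notation W := (@group_C R n).
Local Notation refl := (is_reflection W).
Hypothesis n_gt1 : (1 < n)%N.
Hypothesis gW : W g.
Hypothesis b0_signed : signed b0.
Hypothesis b0_opp : iter n (mulmx g) b0 = - b0.
Hypothesis b0_orth : forall d, (0 < d < n)%N -> dot b0 (iter d (mulmx g) b0) = 0.
Hypothesis b0_surj : forall x, signed x -> exists p, x = iter p (mulmx g) b0.

Definition vertex p := iter p (mulmx g) b0.
Arguments vertex : simpl never.
Local Notation b := vertex.
Local Notation T i j := (reflection (b i - b j)).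

Lemma vertex_signed p : signed (b p).
Proof. exact: iter_signed. Qed.

Lemma vertexS p : g *m b p = b p.+1. Proof. by []. Qed.

Lemma vertex_opp p : b (p + n) = - b p.
Proof. by rewrite /vertex iterD b0_opp iter_mulmxN. Qed.

Lemma vertex_dot1 p : dot (b p) (b p) = 1.
Proof. exact/signed_dot1/vertex_signed. Qed.

Lemma vertex_dot0 p q : (p < q < p + n)%N || (q < p < q + n)%N ->
  dot (b p) (b q) = 0.
Proof.
have gO := group_C_ortho_mat gW.
have H d r : (0 < d < n)%N -> dot (b r) (b (r + d)) = 0.
  move=> dn; elim: r => [|r IH]; first exact: b0_orth.
  by rewrite addSn -!vertexS ortho_mat_dot.
case/orP => pq; [|rewrite dotC].
  by rewrite -(@subnKC p q) ?H //; lia.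
by rewrite -(@subnKC q p) ?H //; lia.
Qed.

Lemma vertex_neq p q : (p < q < p + n + n)%N -> b p <> b q.
Proof.
move=> pq E; have := vertex_dot1 p; rewrite {2}E.
have [lt_qn|lt_nq|->] := ltngtP q (p + n)%N.
- by rewrite vertex_dot0 => [/esym/eqP|]; [rewrite oner_eq0|lia].
- have -> : q = (q - n + n)%N by lia.
  rewrite vertex_opp dotNr vertex_dot0 => [/esym/eqP|]; last by lia.
  by rewrite oppr0 oner_eq0.
rewrite vertex_opp dotNr vertex_dot1 => /eqP.
by rewrite -subr_eq0 -opprD oppr_eq0 -mulr2n pnatr_eq0.
Qed.

Lemma mod_window p i : exists2 q, (i <= q < i + n)%N &
  exists e, (q = p + e * n \/ p = q + e * n)%N.
Proof.
pose r := ((p + i * n - i) %% n)%N.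
have n0 : (0 < n)%N by lia.
have r_lt : (r < n)%N by rewrite ltn_mod.
have E := divn_eq (p + i * n - i) n; rewrite -/r in E.
have le_i : (i <= i * n)%N by nia.
exists (i + r)%N; first by lia.
have [le_d|lt_d] := leqP ((p + i * n - i) %/ n) i.
  exists (i - (p + i * n - i) %/ n)%N; left; nia.
exists ((p + i * n - i) %/ n - i)%N; right; nia.
Qed.

Lemma vertex_shift p e : b (p + e * n) = b p \/ b (p + e * n) = - b p.
Proof.
elim: e => [|e IH]; first by rewrite addn0; left.
have -> : (p + e.+1 * n = p + e * n + n)%N by lia.
by rewrite vertex_opp; case: IH => ->; rewrite ?opprK; [right|left].
Qed.

Lemma vertex_window x i : signed x ->
  exists2 q, (i <= q < i + n)%N & x = b q \/ x = - b q.
Proof.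
move=> /b0_surj[p ->]; rewrite -/(b p).
have [q qi [e [E|E]]] := mod_window p i; exists q => //.
  by rewrite E; case: (vertex_shift p e) => ->; rewrite ?opprK; [left|right].
by rewrite E; case: (vertex_shift q e) => ->; [left|right].
Qed.

Lemma swap_shift i j : T (i + n) (j + n) = T i j.
Proof. by rewrite !vertex_opp -opprD reflectionN. Qed.

Lemma swap_wrap i j : T j (i + n) = T i (j + n).
Proof. by rewrite !vertex_opp !opprK addrC. Qed.

Lemma swap_refl i j : (i < j <= i + n)%N -> refl (T i j).
Proof.
move=> ij; apply: is_reflection_signed; [exact: vertex_signed|exact: vertex_signed|].
by apply/eqP/vertex_neq; lia.
Qed.

(** The reflection in [x - y] is also that in [- x - - y], so that the first
    vector may be taken in the given window. Either [y] or [- y] is in the next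
    half turn; in the second case exchanging the ends, one of them replaced by
    its opposite, gives the chord. *)
Lemma refl_chord t i : refl t ->
  exists k l, [/\ (i <= k < i + n)%N, (k < l <= k + n)%N & t = T k l].
Proof.
case/reflection_signedP => x [y [sx sy xy ->]].
suff H u v : signed v -> u != v -> (exists2 k, (i <= k < i + n)%N & u = b k) ->
    exists k l, [/\ (i <= k < i + n)%N, (k < l <= k + n)%N &
      reflection (u - v) = T k l].
  have [k ki [E|E]] := vertex_window i sx; first by apply: H => //; exists k.
  rewrite -(reflectionN (x - y)) opprB addrC -[y]opprK.
  apply: (H (- x)); [exact: signedN|by rewrite eqr_opp|].
  by exists k => //; rewrite E opprK.
move=> sv uv [k ki uE]; rewrite {u}uE in uv *.
have [q qk [E|E]] := vertex_window k sv.
  rewrite {v}E in sv uv *; exists k, q; split=> //.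
  have: q != k by apply: contraNneq uv => ->.
  lia.
have [qk0|qk0] := eqVneq q k.
  by exists k, (k + n)%N; split; rewrite ?E ?qk0 ?vertex_opp //; lia.
have [q_lt|q_ge] := ltnP q (i + n).
  exists q, (k + n)%N; split; [lia|lia|].
  by rewrite E vertex_opp !opprK addrC.
exists (q - n)%N, k; split; [lia|lia|].
have qE : q = (q - n + n)%N by lia.
by rewrite E {1}qE vertex_opp opprK reflectionBC.
Qed.

Lemma swap_fix k l q : (k < l <= k + n)%N ->
    (k < q < k + n)%N || (q < k < q + n)%N ->
    (l < q < l + n)%N || (q < l < q + n)%N ->
  T k l *m b q = b q.
Proof.
by move=> kl qk ql; apply: reflection_fix; rewrite dotBl !vertex_dot0 ?subrr.
Qed.

Lemma swap_left k l : T k l *m b k = b l.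
Proof. exact: signed_reflection_swap (vertex_signed k) (vertex_signed l). Qed.

Lemma swap_right k l : T k l *m b l = b k.
Proof. by rewrite reflectionBC swap_left. Qed.

Lemma vertex_orb i j : (i <= j)%N -> orb g (b i) (b j).
Proof. by move=> ij; exists (j - i)%N; rewrite -iterD subnK. Qed.

Lemma swap_below i j : (i < j <= i + n)%N -> (rho (T i j *m g)).+1 = rho g.
Proof.
move=> ij; apply: orb_rho => //; first by apply/eqP/vertex_neq; lia.
by apply: vertex_orb; lia.
Qed.

(** As long as [T i j] fixes [b q.+1], the product [T i j *m g] maps [b q] to
    [b q.+1]; so [b k] and [b l] are in the same orbit. *)
Lemma swap_pair i j k l : (i < j <= i + n)%N -> (k < l <= k + n)%N ->
    (forall q, (k < q <= l)%N -> T i j *m b q = b q) ->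
  (rho (T k l *m (T i j *m g))).+2 = rho g.
Proof.
move=> ij kl H; rewrite -(swap_below ij) orb_rho //.
- by apply: group_CM => //; exact/group_C_is_reflection/swap_refl.
- by apply/eqP/vertex_neq; lia.
have Hm m : (k + m <= l)%N -> iter m (mulmx (T i j *m g)) (b k) = b (k + m).
  elim: m => [|m IH] km; first by rewrite addn0.
  by rewrite /= IH -?mulmxA ?vertexS ?addnS ?H //; lia.
by exists (l - k)%N; rewrite Hm subnKC //; lia.
Qed.

(** Pairing the vertices [i, ..., i + n - 1] with this vector gives the
    indicator function of [i, j[. As [T i j *m g] fixes it, it separates the
    two sides of the chord [i, j] in the pairs below [g]. *)
Definition window i j := \sum_(i <= p < j) b p.

Lemma window_dot i j q : (i <= j <= i + n)%N -> (i <= q < i + n)%N ->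
  dot (b q) (window i j) = (q < j)%:R.
Proof.
move=> ij qi; rewrite /window dotC dot_suml.
have H r s : (i <= r)%N -> (r <= s <= i + n)%N -> (s <= q)%N || (q < r)%N ->
    \sum_(r <= p < s) dot (b p) (b q) = 0.
  move=> ir rs qrs; rewrite big_nat big1 // => p ps.
  by apply: vertex_dot0; lia.
have [qj|qj] := ltnP q j; last by rewrite H //; lia.
rewrite (@big_cat_nat _ _ _ q) /=; try lia.
rewrite (@big_ltn _ _ _ q) // vertex_dot1 !H ?addr0 ?add0r //; lia.
Qed.

(** The rotation adds [b j] and removes [b i], and so does the reflection. *)
Lemma window_fix i j : (i < j <= i + n)%N ->
  T i j *m g *m window i j = window i j.
Proof.
move=> ij; have E : g *m window i j = window i j + (b j - b i).
  suff H d : g *m window i (i + d) = window i (i + d) + (b (i + d) - b i).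
    by rewrite -(@subnKC i j) ?H //; lia.
  rewrite /window; elim: d => [|d IH].
    by rewrite addn0 big_geq // mulmx0 subrr addr0.
  rewrite addnS big_nat_recr ?leq_addr //= mulmxDr IH vertexS -!addrA.
  by congr (_ + (_ + _)); rewrite addrC.
suff H : T i j *m window i j = g *m window i j.
  by rewrite -mulmxA -H reflectionKm.
rewrite E reflectionE dotBl window_dot; try lia.
have -> : dot (b j) (window i j) = - (j == i + n)%:R.
  have [->|jn] := eqVneq j (i + n)%N.
    rewrite vertex_opp dotNl window_dot ?ltnn; try lia.
    by have -> : (i < i + n)%N by lia.
  by rewrite window_dot ?ltnn ?oppr0 //; lia.
have ij' : (i < j)%N by lia.
rewrite ij' /= -[b j - b i]opprB; congr (_ - _).
rewrite -[RHS]scale1r; congr (_ *: _).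
rewrite !(dotBl, dotBr) !vertex_dot1 (dotC (b j)).
have [->|jn] := eqVneq j (i + n)%N.
  by rewrite vertex_opp dotNr vertex_dot1 /=; field.
by rewrite vertex_dot0 /=; [field|lia].
Qed.

(** A root of a reflection below [T i j *m g] is orthogonal to its fixed
    vectors. *)
Lemma pair_window i j k l : (i < j <= i + n)%N ->
    (rho (T k l *m (T i j *m g))).+2 = rho g ->
  dot (b k) (window i j) = dot (b l) (window i j).
Proof.
move=> ij kl; have Tij := swap_below ij.
apply/eqP; rewrite -subr_eq0 -dotBl; apply/eqP.
apply: (@rho_moved_fix _ _ _ (T i j *m g)).
- apply/group_C_ortho_mat/group_CM => //.
  exact/group_C_is_reflection/swap_refl.
- by move: kl Tij; move: (rho g) (rho (T i j *m g)) (rho (T k l *m _)); lia.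
exact: window_fix.
Qed.

(** By [pair_window] the ends of [k, l] are on the same side of the chord
    [i, j]. The third case is that of [l] past the half turn, where [b l] is
    the opposite of [b (l - n)]: the two pairings are then equal only if both
    are 0. *)
Lemma pair_cases i j k l : (i < j <= i + n)%N -> (i <= k < i + n)%N ->
    (k < l <= k + n)%N -> (rho (T k l *m (T i j *m g))).+2 = rho g ->
  [\/ (l < j)%N, (j <= k)%N /\ (l < i + n)%N | (j <= k)%N /\ (j + n <= l)%N].
Proof.
move=> ij ik kl /(pair_window ij); rewrite window_dot; try lia.
have [l_lt|l_ge] := ltnP l (i + n).
  rewrite window_dot; try lia.
  have [kj|kj] := ltnP k j; have [lj|lj] := ltnP l j => /eqP;
    rewrite ?oner_eq0 ?[0 == 1]eq_sym ?oner_eq0 // => _; try lia.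
  - by constructor 1.
  by constructor 2.
have El : l = (l - n + n)%N by lia.
rewrite {1}El vertex_opp dotNl window_dot; try lia.
have [kj|kj] := ltnP k j; have [lj|lj] := ltnP (l - n) j => /eqP.
- by rewrite -subr_eq0 opprK -natrD pnatr_eq0.
- by rewrite oppr0 oner_eq0.
- by rewrite eq_sym oppr_eq0 oner_eq0.
by move=> _; constructor 3; lia.
Qed.

Lemma no_two_sign_changes x y : signed x -> signed y ->
  (rho (reflection (y - - y) *m (reflection (x - - x) *m g))).+2 <> rho g.
Proof.
move=> /b0_surj[i ->] sy; rewrite -/(b i) -vertex_opp.
have [k ik yE] := vertex_window i sy.
have -> : reflection (y - - y) = T k (k + n).
  by case: yE => ->; rewrite vertex_opp; [|rewrite reflectionBC opprK].
move=> E; have := pair_cases _ ik _ E => -[]; lia.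
Qed.

(** * Values on chords that respect the pairs below the Coxeter element

    Apart from periodicity, the relations assumed of [ch] are those for the
    shapes that two chords in a pair below [g] can have. *)
Section ChordLift.
Variables (A : groupType) (ch : nat -> nat -> A).
Hypothesis ch_per : forall i j, (i < j)%N -> ch (i + n)%N (j + n)%N = ch i j.
Hypothesis ch_disjoint : forall i j k l,
  (i < j)%N -> (j < k)%N -> (k < l)%N -> (l < i + n)%N ->
  (ch i j * ch k l = ch k l * ch i j)%g.
Hypothesis ch_nested : forall i j k l, (i < k < l)%N -> (l < j <= i + n)%N ->
  (ch i j * ch k l = ch k l * ch i j)%g.
Hypothesis ch_triangle1 : forall i j k, (i < j < k)%N -> (k < i + n)%N ->
  (ch i j * ch j k = ch i k * ch i j)%g.
Hypothesis ch_triangle2 : forall i j k, (i < j < k)%N -> (k < i + n)%N ->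
  (ch i j * ch j k = ch j k * ch i k)%g.
Hypothesis ch_square1 : forall i j, (i < j < i + n)%N ->
  (ch i (i + n) * ch i j = ch i j * ch j (j + n))%g.
Hypothesis ch_square2 : forall i j, (i < j < i + n)%N ->
  (ch i j * ch j (j + n) = ch j (j + n) * ch j (i + n))%g.

Lemma ch_shift i j e : (i < j)%N -> ch (i + e * n)%N (j + e * n)%N = ch i j.
Proof.
move=> ij; elim: e => [|e IH]; first by rewrite !addn0.
by rewrite !mulSn ![(n + e * n)%N]addnC !addnA ch_per //; lia.
Qed.

Lemma swap_shift_mul i j e : T (i + e * n) (j + e * n) = T i j.
Proof.
elim: e => [|e IH]; first by rewrite !addn0.
by rewrite !mulSn ![(n + e * n)%N]addnC !addnA swap_shift.
Qed.

Lemma vertex_eq_mod p q : dot (b p) (b q) != 0 ->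
  exists e, p = (q + e * n)%N \/ q = (p + e * n)%N.
Proof.
have [p' pp' [e pe]] := mod_window p q => pq.
suff Epq : p' = q.
  by rewrite Epq in pe; exists e; case: pe => ->; [right|left].
apply/eqP; apply: contraNT pq => p'q; apply/eqP.
have p'0 : dot (b p') (b q) = 0 by rewrite vertex_dot0 //; lia.
case: pe => pe; rewrite pe in p'0 *.
  by case: (vertex_shift p e) p'0 => -> //; rewrite dotNl => /eqP;
    rewrite oppr_eq0 => /eqP.
by case: (vertex_shift p' e) => ->; rewrite ?dotNl p'0 ?oppr0.
Qed.

(** A reflection determines its chord up to half turns: one end of
    [i', j'] is [b i] up to sign, and the reflection then gives the other end.
    If [b i] is at [j'] the reflection forces that chord to be a diameter,
    whose ends may be exchanged. *)
Lemma ch_swap_eq i j i' j' : (i < j <= i + n)%N -> (i' < j' <= i' + n)%N ->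
  T i j = T i' j' -> ch i j = ch i' j'.
Proof.
have H1 i1 j1 i2 j2 e : (i1 < j1 <= i1 + n)%N -> (i2 < j2 <= i2 + n)%N ->
    i1 = (i2 + e * n)%N -> T i1 j1 = T i2 j2 -> ch i1 j1 = ch i2 j2.
  move=> b1 b2 iE E; rewrite -(@ch_shift i2 j2 e); last by lia.
  rewrite -(swap_shift_mul i2 j2 e) -iE in E; rewrite -iE; congr (ch _ _).
  have bE : b j1 = b (j2 + e * n) by rewrite -(swap_left i1 j1) E swap_left.
  apply/eqP; apply: contraT => jne.
  have [lt_j|lt_j] : (j1 < j2 + e * n)%N \/ (j2 + e * n < j1)%N by lia.
    by case: (@vertex_neq j1 (j2 + e * n)) => //; lia.
  by case: (@vertex_neq (j2 + e * n) j1) => //; lia.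
have H2 i1 j1 i2 : (i1 < j1 <= i1 + n)%N -> (i2 < i1 <= i2 + n)%N ->
    T i1 j1 = T i2 i1 -> i1 = (i2 + n)%N.
  move=> b1 b2 E; have bE : b i2 = b j1 by rewrite -(swap_left i1 j1) E swap_right.
  apply/eqP; apply: contraT => ne; case: (@vertex_neq i2 j1) => //; lia.
move=> b1 b2 E.
have d0 : dot (b i' - b j') (b i) != 0.
  apply/negP => /eqP/reflection_fix E0.
  by case: (@vertex_neq i j); [lia|rewrite -(swap_left i j) E E0].
have [di|di] := boolP (dot (b i') (b i) == 0); last first.
  have [e [iE|iE]] := vertex_eq_mod di; last exact: (H1 _ _ _ _ e).
  by apply/esym; apply: (H1 _ _ _ _ e).
rewrite dotBl (eqP di) sub0r oppr_eq0 in d0.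
have [e [jE|jE]] := vertex_eq_mod d0; last first.
  have iE : i = (i' + e * n + n)%N.
    apply: (H2 i j) => //; first by lia.
    by rewrite E jE swap_shift_mul.
  by apply: (H1 _ _ _ _ e.+1) => //; lia.
have iE : j' = (i' + n)%N.
  apply: (H2 j' (j + e * n)%N); [lia|lia|].
  by rewrite {1}jE swap_shift_mul.
have [e0|e0] := posnP e.
  by apply: (H1 _ _ _ _ 1%N) => //; lia.
by apply/esym; apply: (H1 _ _ _ _ e.-1) => //; nia.
Qed.

(** Every reflection is that of some chord, so the default value is never
    met. *)
Definition chord_value (t : 'M[R]_n) : A :=
  let ij := xget (0%N, 0%N)
    [set ij | (ij.1 < ij.2 <= ij.1 + n)%N /\ t = T ij.1 ij.2]%classic in
  ch ij.1 ij.2.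

Lemma chord_valueE i j : (i < j <= i + n)%N -> chord_value (T i j) = ch i j.
Proof.
move=> ij; rewrite /chord_value; set P := [set _ | _]%classic.
have [] : P (xget (0%N, 0%N) P) by apply: xgetPex; exists (i, j).
by move=> b1 E; apply/esym/ch_swap_eq.
Qed.

Lemma swap_conj p k l i j : T k l *m b i = b p -> forall q,
  T k l *m b j = b q -> T k l *m T i j *m T k l = T p q.
Proof.
move=> ip q jq; rewrite -{2}(reflection_sym (b k - b l)).
by rewrite reflection_conj ?mulmxBr ?ip ?jq //; exact: reflection_ortho_mat.
Qed.

Local Notation L := chord_value.

Lemma chord_value_pair t t' : refl t -> refl t' ->
  (rho (t' *m (t *m g))).+2 = rho g ->
  (L t * L t')%g = (L t' * L (t' *m t *m t'))%g.
Proof.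
move=> /(refl_chord 0)[i [j [_ ij ->]]] /(refl_chord i)[k [l [ik kl ->]]] H.
have commuting : T k l *m b i = b i -> T k l *m b j = b j ->
    (ch i j * ch k l = ch k l * ch i j)%g ->
    (L (T i j) * L (T k l) = L (T k l) * L (T k l *m T i j *m T k l))%g.
  by move=> bi bj E; rewrite (swap_conj bi bj) !chord_valueE.
have chn : (i < j)%N -> ch (i + n)%N (j + n)%N = ch i j by exact: ch_per.
case: (pair_cases ij ik kl H) => [lj|[jk li]|[jk jl]].
- have [ki|ki] := eqVneq k i; last first.
    by apply: commuting;
      [apply: swap_fix; lia|apply: swap_fix; lia|apply: ch_nested; lia].
  rewrite {k}ki in ik kl H commuting *; have [jn|jn] := eqVneq j (i + n)%N.
    rewrite {j}jn in ij lj H commuting chn *.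
    rewrite (swap_conj (swap_left i l) (_ : _ = b (l + n))); last first.
      by rewrite !vertex_opp mulmxN swap_left.
    by rewrite !chord_valueE ?ch_square1 //; lia.
  rewrite (swap_conj (swap_left i l) (_ : _ = b j)); last by apply: swap_fix; lia.
  by rewrite !chord_valueE -?ch_triangle1 //; lia.
- have [kj|kj] := eqVneq k j; last first.
    apply: commuting; [apply: swap_fix; lia|apply: swap_fix; lia|].
    by apply: ch_disjoint; lia.
  rewrite {k}kj in ik kl jk H commuting *.
  rewrite (swap_conj (_ : _ = b i) (swap_left j l)); last by apply: swap_fix; lia.
  by rewrite !chord_valueE ?ch_triangle2 //; lia.
have [lj|lj] := eqVneq l (j + n)%N; last first.
  have fixn q : T k l *m b (q + n) = b (q + n) -> T k l *m b q = b q.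
    by rewrite vertex_opp mulmxN => /oppr_inj.
  apply: commuting;
    [apply: fixn; apply: swap_fix; lia|apply: fixn; apply: swap_fix; lia|].
  by rewrite -chn; [apply/esym/ch_nested; lia|lia].
rewrite {l}lj in kl jl H commuting *.
have bi : T k (j + n) *m b i = b i.
  by apply: reflection_fix; rewrite vertex_opp opprK dotDl !vertex_dot0 ?addr0 //; lia.
have bj : T k (j + n) *m b j = b (k + n).
  have jE : b j = - b (j + n) by rewrite vertex_opp opprK.
  by rewrite [X in _ *m X]jE mulmxN swap_right vertex_opp.
rewrite (swap_conj bi bj) -(swap_wrap i k); have [kj|kj] := eqVneq k j.
  by rewrite kj in ik kl *; rewrite !chord_valueE ?ch_square2 //; lia.
rewrite !chord_valueE; try lia.
have knk : (k < i + n < j + n)%N by lia.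
have jnk : (j + n < k + n)%N by lia.
rewrite -chn; last by lia.
by rewrite -(ch_triangle2 knk jnk) (ch_triangle1 knk jnk).
Qed.

End ChordLift.

(** * The Artin relations in the poset group *)

Local Notation Gam := (poset_group W g).
Local Notation el := (elt g).

Lemma elt_triangle i j k : (i < j < k)%N -> (k < i + n)%N ->
  (el (T i j) * el (T j k) = el (T j k) * el (T i k))%g /\
  (el (T j k) * el (T i k) = el (T i k) * el (T i j))%g.
Proof.
move=> ijk kn; have ij : refl (T i j) by apply: swap_refl; lia.
have jk : refl (T j k) by apply: swap_refl; lia.
have ik : refl (T i k) by apply: swap_refl; lia.
have H : (rho (T j k *m (T i j *m g))).+2 = rho g.
  by apply: swap_pair => [||q qk]; [lia|lia|apply: swap_fix; lia].
have E1 : T j k *m T i j *m T j k = T i k.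
  by apply: swap_conj; [apply: swap_fix; lia|exact: swap_left].
have E2 : T i k *m T j k *m T i k = T i j.
  rewrite [RHS]reflectionBC; apply: swap_conj; last exact: swap_right.
  by apply: swap_fix; lia.
have H' := pair_next jk H; rewrite E1 in H'.
by rewrite (elt_braid gW ij jk H) E1 (elt_braid gW jk ik H') E2.
Qed.

(** The four reflections of a subgroup of type B2, in the order in which the
    product of each with the next is the same rotation. *)
Lemma elt_square :
  (el (T 0 n) * el (T 0 1) * el (T 0 n) * el (T 0 1) =
   el (T 0 1) * el (T 0 n) * el (T 0 1) * el (T 0 n))%g.
Proof.
have aR : refl (T 0 n) by apply: swap_refl; lia.
have bR : refl (T 0 1) by apply: swap_refl; lia.
have cR : refl (T 1 n.+1) by apply: swap_refl; lia.
have bn1 : b n.+1 = - b 1 by exact: (vertex_opp 1).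
have bn : b n = - b 0 by exact: (vertex_opp 0).
have dR : refl (T 0 n.+1).
  apply: is_reflection_signed; [exact: vertex_signed|exact: vertex_signed|].
  by apply/eqP/vertex_neq; lia.
have H1 : (rho (T 0 1 *m (T 0 n *m g))).+2 = rho g.
  apply: swap_pair => [||q qk]; [lia|lia|].
  by have -> : q = 1%N by [lia]; apply: swap_fix; lia.
have E1 : T 0 1 *m T 0 n *m T 0 1 = T 1 n.+1.
  apply: swap_conj; first exact: swap_left.
  by rewrite bn bn1 mulmxN swap_left.
have E2 : T 1 n.+1 *m T 0 1 *m T 1 n.+1 = T 0 n.+1.
  apply: swap_conj; last exact: swap_left.
  by apply: reflection_fix; rewrite bn1 opprK dotDl
    vertex_dot0 ?addr0 //; lia.
have E3 : T 0 n.+1 *m T 1 n.+1 *m T 0 n.+1 = T 0 n.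
  rewrite [RHS]reflectionBC; apply: swap_conj; last exact: swap_right.
  have -> : b 1 = - b n.+1 by rewrite bn1 opprK.
  by rewrite mulmxN swap_right -bn.
have H2 := pair_next bR H1; rewrite E1 in H2.
have H3 := pair_next cR H2; rewrite E2 in H3.
refine (@braid4_of_square Gam (el (T 0 n)) (el (T 0 1))
  (el (T 1 n.+1)) (el (T 0 n.+1)) _ _ _).
- by rewrite (elt_braid gW aR bR H1) E1.
- by rewrite (elt_braid gW bR cR H2) E2.
by rewrite (elt_braid gW cR dR H3) E3.
Qed.

Lemma elt_commute i j k : (i < j <= i + n)%N ->
    T i j *m b k.+1 = b k.+1 -> T i j *m b k = b k ->
  commute (el (T i j)) (el (T k k.+1)).
Proof.
move=> ij fk1 fk; have kR : refl (T k k.+1) by apply: swap_refl; lia.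
have H : (rho (T k k.+1 *m (T i j *m g))).+2 = rho g.
  by apply: swap_pair => [||q qk]; [lia|lia|have -> : q = k.+1 by [lia]].
rewrite /commute (elt_braid gW (swap_refl ij) kR H); congr (_ * el _)%g.
have d0 q : T i j *m b q = b q -> dot (b i - b j) (b q) = 0.
  rewrite reflectionE => /eqP.
  rewrite -subr_eq0 addrAC subrr sub0r oppr_eq0 scaler_eq0 !mulf_eq0.
  have nz : b i - b j != 0.
    rewrite subr_eq0; apply/eqP/vertex_neq; lia.
  by rewrite pnatr_eq0 invr_eq0 dot_eq0 (negPf nz) !orbF /= => /eqP.
rewrite -[X in _ *m X](reflection_sym (b k - b k.+1)).
rewrite reflection_conj; last exact: reflection_ortho_mat.
by rewrite reflection_fix // dotC dotBr !d0 ?subrr.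
Qed.

(** The images of the generators of the Artin group: one diameter and
    consecutive sides starting at its end [b 0]. *)
Definition simple_refl p : 'M[R]_n := if p is p'.+1 then T p' p else T 0 n.

Lemma simple_reflP p : (p < n)%N -> refl (simple_refl p).
Proof. by case: p => [|p] pn; apply: swap_refl; lia. Qed.

Let y p := el (simple_refl p).

Lemma elt_braid4 : (y 0 * y 1 * y 0 * y 1 = y 1 * y 0 * y 1 * y 0)%g.
Proof. exact: elt_square. Qed.

Lemma elt_braid3 i : (0 < i)%N -> (i.+1 < n)%N ->
  (y i * y i.+1 * y i = y i.+1 * y i * y i.+1)%g.
Proof.
case: i => [|i] i0 iN; first by rewrite ltnn in i0.
have [||E1 E2] := @elt_triangle i i.+1 i.+2; try lia.
exact: braid3_of_triangle E1 E2.
Qed.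

Lemma elt_comm i j : (i.+2 <= j)%N -> (j < n)%N -> commute (y i) (y j).
Proof.
case: j => // j; case: i => [|i] ij jn; apply: elt_commute; try lia;
  by apply: swap_fix; lia.
Qed.

(** The pairing of [b p] with a fixed vector of [g] does not depend on [p], but
    changes sign with a half turn. *)
Lemma rho_cox : rho g = n.
Proof.
have gO := group_C_ortho_mat gW; apply: rho_full => x gx.
have bx p : dot (b p) x = dot (b 0) x.
  by elim: p => // p IH; rewrite -vertexS -[in LHS]gx ortho_mat_dot.
have b0x : dot (b 0) x = 0.
  have := bx (0 + n)%N; rewrite vertex_opp dotNl => /eqP.
  by rewrite -subr_eq0 -opprD oppr_eq0 -mulr2n mulrn_eq0 => /eqP.
apply/matrixP => k j; rewrite ord1 [RHS]mxE -dot_unitv.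
have [p ->] := b0_surj (signed_unitv R k).
by rewrite -/(b p) bx.
Qed.

Lemma simple_refl_prod : mulmxs [seq simple_refl p | p <- iota 0 n] = g.
Proof.
(* The sides [k, k + 1], ..., [k + m - 1, k + m] multiply to the cycle through
   [b k, ..., b (k + m)]. *)
have H m k : (k + m < n)%N ->
    let M := mulmxs [seq simple_refl p | p <- iota k.+1 m] in
    [/\ forall q, (q < k)%N -> M *m b q = b q,
        forall q, (k <= q < k + m)%N -> M *m b q = b q.+1 &
        M *m b (k + m) = b k].
  elim: m k => [|m IH] k km /=.
    rewrite addn0; split=> [q _|q|]; rewrite ?mul1mx //; lia.
  have [|F1 F2 F3] := IH k.+1; first by lia.
  split=> [q qk|q kq|].
  - by rewrite -mulmxA F1; [apply: swap_fix; lia|lia].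
  - rewrite -mulmxA; have [->|qk] := eqVneq q k.
      by rewrite F1; [exact: swap_left|lia].
    by rewrite F2; [apply: swap_fix; lia|lia].
  by rewrite -mulmxA addnS -addSn F3 swap_right.
have [|_ F2 F3] := H n.-1 0%N; first by lia.
have E q : (0 <= q < 0 + n)%N ->
    mulmxs [seq simple_refl p | p <- iota 0 n] *m b q = g *m b q.
  have -> : iota 0 n = 0%N :: iota 1 n.-1 by rewrite -{1}(prednK (ltnW n_gt1)).
  rewrite /= -mulmxA vertexS => qn; have [q_lt|q_ge] := ltnP q n.-1.
    by rewrite F2; [apply: swap_fix; lia|lia].
  have -> : q = (0 + n.-1)%N by lia.
  by rewrite F3 swap_left; congr b; lia.
apply/matrixP => i k; rewrite -!mulmx_unitv.
have [q qn kE] := vertex_window 0 (signed_unitv R k).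
by case: kE => ->; rewrite ?mulmxN E.
Qed.

Lemma cox_prod_elt : cox_prod n y = el g.
Proof.
have gg : wle g g by rewrite /wle (group_C_ortho_mat gW) rho1 addn0.
pose r := [seq simple_refl p | p <- iota 0 n].
have rE : mulmxs r = g := simple_refl_prod.
have rR : refls r.
  by move=> t /mapP[p]; rewrite mem_iota => pn ->; apply: simple_reflP; lia.
have := elt_word gW rR; rewrite rE => -> //; last first.
  by rewrite size_map size_iota rho_cox.
by rewrite big_map /cox_prod /index_iota subn0.
Qed.

(** * The two maps *)

Local Notation Art := (artin_C n).
Local Notation x := (artin_gen n).

Let x_braid4 := artin_braid4 n_gt1.
Let x_braid3 := @artin_braid3 n.
Let x_comm := @artin_comm n.

Local Notation ch := (chord n (rotated n x) (cox_prod n x)).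
Local Notation L := (chord_value ch).

Let tau_s := cox_prod_rotated n x.
Let s_per := rotated_per n_gt1 x_braid4 x_braid3 x_comm.
Let s_braid := rotated_braid n_gt1 x_braid3 x_comm.
Let s_comm := rotated_comm n_gt1 x_braid3 x_comm.

Let L_swap i j : (i < j <= i + n)%N -> L (T i j) = ch i j.
Proof.
apply: chord_valueE => //; exact: (chord_per (cox_prod n x) s_per).
Qed.

Let L_pair t t' : refl t -> refl t' ->
  (rho (t' *m (t *m g))).+2 = rho g ->
  (L t * L t')%g = (L t' * L (t' *m t *m t'))%g.
Proof.
apply: chord_value_pair => //.
- exact: (chord_per (cox_prod n x) s_per).
- exact: (chord_disjoint (cox_prod n x) n_gt1 s_comm).
- exact: (chord_nested n_gt1 tau_s s_braid s_comm).
- exact: (chord_triangle1 (cox_prod n x) n_gt1 s_comm).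
- exact: (chord_triangle2 n_gt1 tau_s s_braid s_comm).
- exact: (chord_square1 n_gt1 tau_s s_per s_braid s_comm).
exact: (chord_square2 n_gt1 tau_s s_per s_braid s_comm).
Qed.

Let Lword_eq := Lword_reduced no_two_sign_changes L_pair.

Definition poset_to_artin_gen (w : poset_interval W g) : Art :=
  Lword L (rword (val w)).

(** Reduced words of [w1] and of [w2] form together one of [w3], and the value
    does not depend on the reduced word. *)
Lemma poset_to_artin_rels u v : poset_rels u v ->
  eval_word poset_to_artin_gen u = eval_word poset_to_artin_gen v.
Proof.
case=> w1 w2 w3 le13 E2; rewrite /eval_word !big_cons !big_nil /= !mulg1.
have /poset_intervalE - /(_ gW)[W1 le1 _] := set_mem (valP w1).
have /poset_intervalE - /(_ gW)[W2 le2 _] := set_mem (valP w2).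
have /poset_intervalE - /(_ gW)[W3 le3 _] := set_mem (valP w3).
have O1 := group_C_ortho_mat W1.
have [r1R r1E r1s] := rwordP W1; have [r2R r2E r2s] := rwordP W2.
rewrite /poset_to_artin_gen -(Lword_eq W3 le3 (r := rword (val w1) ++ rword (val w2))).
- by rewrite /Lword big_cat.
- exact: refls_cat.
- by rewrite mulmxs_cat r1E r2E E2 ortho_mat_inv // ortho_matKV.
rewrite size_cat r1s r2s E2 ortho_mat_inv //.
by move/(refl_leE W1 W3): le13.
Qed.

Definition poset_to_artin : Gam -> Art := pres_lift poset_to_artin_gen.

Lemma poset_to_artinM : {morph poset_to_artin : u v / (u * v)%g}.
Proof. exact: pres_liftM poset_to_artin_rels. Qed.

Lemma poset_to_artin_val (w : poset_interval W g) :
  poset_to_artin (gen (@poset_rels R n W g) w) = Lword L (rword (val w)).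
Proof. exact: (pres_lift_gen poset_to_artin_rels). Qed.

Lemma poset_to_artin_swap i j : (i < j <= i + n)%N ->
  poset_to_artin (el (T i j)) = ch i j.
Proof.
move=> ij; have tR := swap_refl ij; have tW := group_C_is_reflection tR.
have tg : wle (T i j) g.
  by apply/wle_reflection => //; apply: swap_below.
have tI : poset_interval W g (T i j).
  apply/poset_intervalE => //; split=> // E.
  by have := is_reflection_rho tR; rewrite E rho1.
pose w : poset_interval W g := exist _ (T i j) (mem_set tI).
rewrite -[T i j]/(val w) elt_val poset_to_artin_val -L_swap // /poset_to_artin_gen.
rewrite -(Lword_eq tW tg (r := [:: T i j])).
- by rewrite /Lword big_seq1.
- by apply/refls_cons.
- by rewrite /= mulmx1.
by rewrite (is_reflection_rho tR).
Qed.

Definition artin_to_poset_gen (i : 'I_n) : Gam := y i.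

Lemma artin_to_poset_rels u v : artin_C_rels u v ->
  eval_word artin_to_poset_gen u = eval_word artin_to_poset_gen v.
Proof.
case=> [i j i0 j1|i j i0 ji|i j ij];
  rewrite /eval_word !big_cons !big_nil /= !mulg1 /artin_to_poset_gen ?mulgA.
- rewrite i0 j1; exact: elt_braid4.
- rewrite ji; apply: elt_braid3 => //; rewrite -ji; exact: ltn_ord.
by case/orP: ij => ij; [|symmetry]; apply: elt_comm.
Qed.

Definition artin_to_poset : Art -> Gam := pres_lift artin_to_poset_gen.

Lemma artin_to_posetM : {morph artin_to_poset : u v / (u * v)%g}.
Proof. exact: pres_liftM artin_to_poset_rels. Qed.

Lemma artin_to_poset_gen_val p : (p < n)%N -> artin_to_poset (x p) = y p.
Proof.
move=> pn; rewrite -[p]/(val (Ordinal pn)) artin_genE.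
exact: (pres_lift_gen artin_to_poset_rels).
Qed.

Lemma artin_to_poset_cox : artin_to_poset (cox_prod n x) = el g.
Proof.
rewrite -cox_prod_elt /cox_prod big_nat [RHS]big_nat.
rewrite (morph_mul_prod artin_to_posetM).
by apply: eq_bigr => p /andP[_ pn]; rewrite artin_to_poset_gen_val.
Qed.

Lemma elt_rotate i j : (i < j <= i + n)%N ->
  (el g * el (T i j) = el (T i.+1 j.+1) * el g)%g.
Proof.
move=> ij; rewrite elt_conj //; [|exact: swap_refl|exact: swap_below].
by rewrite reflection_conj ?mulmxBr ?vertexS //; exact: group_C_ortho_mat.
Qed.

(** The image of the Coxeter product is [g], so both sides are rotated in the
    same way; this reduces the claim for sides and diameters to the generators.
    The other chords follow by the triangle relation, by induction on their
    length. *)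
Lemma artin_to_poset_chord i j : (i < j <= i + n)%N ->
  artin_to_poset (ch i j) = el (T i j).
Proof.
have s_refl k : artin_to_poset (rotated n x k) = el (T k k.+1).
  elim: k => [|k IH]; first by rewrite rotated0 artin_to_poset_gen_val.
  apply: (mulIg (el g)); rewrite -elt_rotate; last by lia.
  by rewrite -artin_to_poset_cox -artin_to_posetM -cox_prod_rotated artin_to_posetM IH.
have long k : artin_to_poset (ch k (k + n)) = el (T k (k + n)).
  elim: k => [|k IH].
    by rewrite (chord_diameter n_gt1 x_braid3 x_comm) artin_to_poset_gen_val //; lia.
  apply: (mulIg (el g)); rewrite addSn -elt_rotate; last by lia.
  have kn : (k < k + n <= k + n)%N by lia.
  rewrite -artin_to_poset_cox -artin_to_posetM.
  rewrite -(tau_chord n_gt1 tau_s s_braid s_comm kn).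
  by rewrite artin_to_posetM IH.
move=> /andP[ij]; rewrite leq_eqVlt => /orP[/eqP->|jn]; first exact: long.
have -> : j = (i + (j - i.+1).+1)%N by lia.
have : (i + (j - i.+1).+1 < i + n)%N by lia.
elim: (j - i.+1)%N => [|m IH] mn; first by rewrite addn1 chord1.
have IH' := IH ltac:(lia).
apply: (mulIg (el (T i (i + m.+1)))).
rewrite -{1}IH' -artin_to_posetM [(i + m.+2)%N]addnS.
rewrite -(chord_triangle1 (cox_prod n x) n_gt1 s_comm); try lia.
rewrite artin_to_posetM IH' chord1 // s_refl.
by have [||-> ->] := @elt_triangle i (i + m.+1) (i + m.+1).+1; try lia.
Qed.

(** An element of the interval is the product of a reduced word, whose letters
    are chords. *)
Lemma poset_to_artinK : cancel poset_to_artin artin_to_poset.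
Proof.
have compM : {morph (artin_to_poset \o poset_to_artin) : u v / (u * v)%g}.
  by move=> u v /=; rewrite poset_to_artinM artin_to_posetM.
apply: (pres_ext compM (q := id)) => // w /=.
have /poset_intervalE - /(_ gW)[wW wg _] := set_mem (valP w).
have [rR rE rs] := rwordP wW.
rewrite poset_to_artin_val -elt_val -[in RHS]rE elt_word ?rE //.
rewrite /Lword (morph_mul_prod artin_to_posetM) big_seq [RHS]big_seq.
apply: eq_bigr => t /rR tR.
have [i [j [_ ij ->]]] := refl_chord 0 tR.
by rewrite L_swap // artin_to_poset_chord.
Qed.

Lemma artin_to_posetK : cancel artin_to_poset poset_to_artin.
Proof.
have compM : {morph (poset_to_artin \o artin_to_poset) : u v / (u * v)%g}.
  by move=> u v /=; rewrite artin_to_posetM poset_to_artinM.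
apply: (pres_ext compM (q := id)) => // i /=.
rewrite -artin_genE artin_to_poset_gen_val // /y /simple_refl.
case: (i : nat) (ltn_ord i) => [|p] pn; rewrite poset_to_artin_swap; try lia.
  exact: (chord_diameter n_gt1 x_braid3 x_comm).
by have := chord_side n_gt1 x_braid3 x_comm (i := p.+1); apply; lia.
Qed.

Lemma isomorphic_poset_artin : isomorphic Gam Art.
Proof.
pose f : {multiplicative Gam -> Art} :=
  HB.pack poset_to_artin (isMultiplicative.Build _ _ poset_to_artin poset_to_artinM).
by exists f; exists artin_to_poset; [exact: poset_to_artinK|exact: artin_to_posetK].
Qed.

End Chords.

Theorem theorem6p8 (R : realType) (n : nat) (hn : (2 <= n)%N)
    (g : 'M[R]_n) (hg : coxeter_element (@group_C R n) g) :
  isomorphic (poset_group (@group_C R n) g) (artin_C n).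
Proof.
case: hg => m [A A_simple gE].
have gW : group_C g.
  rewrite gE big_mulmxs; apply: refls_group_C => t /mapP[i _ ->].
  by exists (col i A) => //; case: A_simple.
have [b0 b0_signed []] := simple_product_cycle (ltnW hn) A_simple.
rewrite -gE => b0_opp b0_orth b0_surj.
exact: (isomorphic_poset_artin hn gW b0_signed b0_opp b0_orth b0_surj).
Qed.
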